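(* Let $n\ge1$ and let $c,d$ be complex parameters. The sequences (indexed by $n$-tuples $\boldsymbol k$ of nonnegative integers) \begin{align*} \alpha_{\boldsymbol k}(a,b)&:=\prod_{r=1}^n\frac{\theta(ax_rq^{k_r+|\boldsymbol k|};p)}{\theta(ax_r;p)}\frac{(ax_r;q,p)_{|\boldsymbol k|}(dx_r;q,p)_{k_r}}{(ax_rq/c,\,bcdx_r/a;q,p)_{k_r}}\cdot\frac{(c,\,a^2q/(bcd);q,p)_{|\boldsymbol k|}}{(aq/d;q,p)_{|\boldsymbol k|}\prod_{r,s=1}^n(qx_r/x_s;q,p)_{k_r}}\left(\frac ba\right)^{|\boldsymbol k|} \end{align*} and \begin{align*} \beta_{\boldsymbol k}(a,b)&:=\frac{(bc/a,\,aq/(cd);q,p)_{|\boldsymbol k|}}{(aq/d;q,p)_{|\boldsymbol k|}\prod_{r,s=1}^n(qx_r/x_s;q,p)_{k_r}}\prod_{r=1}^n\frac{(bx_r;q,p)_{|\boldsymbol k|}(bdx_r/a;q,p)_{k_r}}{(ax_rq/c,\,bcdx_r/a;q,p)_{k_r}} \end{align*} form a WP Bailey pair with respect to the matrix $\mathbf B^{(1)}$.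
   Context: Let $q,p$ be complex numbers with $q\neq 0$ and $|p|<1$. For $a\ne 0$ put $\theta(a;p)=\prod_{j\ge 0}(1-ap^j)(1-p^{j+1}/a)$. For an integer $k$ the $q,p$-shifted factorial is $(a;q,p)_k=\prod_{j=0}^{k-1}\theta(aq^j;p)$ if $k\ge 0$ (empty product $=1$), and $(a;q,p)_{k}=\big(\prod_{j=k}^{-1}\theta(aq^{j};p)\big)^{-1}$ if $k<0$. Write $(a_1,\dots,a_m;q,p)_k=(a_1;q,p)_k\cdots(a_m;q,p)_k$. For a tuple $\boldsymbol k=(k_1,\dots,k_n)$, $|\boldsymbol k|=k_1+\cdots+k_n$. The $x_1,\dots,x_n$ are fixed complex parameters. All parameters are nonzero and generic in the sense that no denominators vanish. WP Bailey pair: given a matrix $\mathbf B=(B_{\boldsymbol k\boldsymbol j}(a,b))$ indexed by $n$-tuples of nonnegative integers, sequences $\alpha_{\boldsymbol N}(a,b)$ and $\beta_{\boldsymbol N}(a,b)$ form a WP Bailey pair with respect to $\mathbf B$ if for all $n$-tuples $\boldsymbol N$ of nonnegative integers $$\beta_{\boldsymbol N}(a,b)=\sum_{0\le j_r\le N_r,\ r=1,\dots,n}B_{\boldsymbol N\boldsymbol j}(a,b)\,\alpha_{\boldsymbol j}(a,b).$$ The matrix $\mathbf B^{(1)}$ has entries $$B^{(1)}_{\boldsymbol k\boldsymbol j}(a,b)=\frac{(b/a;q,p)_{|\boldsymbol k|-|\boldsymbol j|}}{\prod_{r,s=1}^n(q^{1+j_r-j_s}x_r/x_s;q,p)_{k_r-j_r}}\prod_{r=1}^n\frac{(bx_r;q,p)_{j_r+|\boldsymbol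 k|}}{(ax_rq;q,p)_{k_r+|\boldsymbol j|}}.$$ *)

(* Defs.v *)
From HB Require Import structures.
From mathcomp Require Import all_boot all_order all_algebra.
From mathcomp Require Export complex.
From mathcomp Require Import boolp classical_sets functions.
From mathcomp Require Export reals.
From mathcomp Require Import topology normedtype sequences.

Set Implicit Arguments.
Unset Strict Implicit.
Unset Printing Implicit Defensive.

Import Order.TTheory GRing.Theory Num.Theory.
Import numFieldNormedType.Exports.

Local Open Scope classical_set_scope.
Local Open Scope ring_scope.

(* The infinite product is the limit of its partial products; over the complex
   numbers it converges whenever `|p| < 1 and a != 0. The case p = 0 is
   allowed, and gives theta 0 a = 1 - a since 0 ^+ 0 = 1. *)
Definition theta (C : numFieldType) (p a : C) : C :=
  limn (fun m : nat => \prod_(0 <= j < m) ((1 - a * p ^+ j) * (1 - p ^+ j.+1 / a))).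

(* Negz m is - m.+1, so in the second case the exponents Negz j run over
   -1, ..., - m.+1. *)
Definition qpfact (C : numFieldType) (q p a : C) (k : int) : C :=
  match k with
  | Posz m => \prod_(0 <= j < m) theta p (a * q ^+ j)
  | Negz m => (\prod_(0 <= j < m.+1) theta p (a * q ^ (Negz j)))^-1
  end.

Definition qpfacts (C : numFieldType) (q p : C) (s : seq C) (k : int) : C :=
  \prod_(a <- s) qpfact q p a k.

Definition mindex (n : nat) : Type := 'I_n -> nat.

Definition mabs (n : nat) (k : mindex n) : nat := (\sum_(r < n) k r)%N.

(* The summation index ranges over the box 0 <= j r <= N r. *)
Definition WP_Bailey_pair (C : numFieldType) (n : nat)
    (B : C -> C -> mindex n -> mindex n -> C)
    (alpha beta : C -> C -> mindex n -> C) (a b : C) : Prop :=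
  forall N : mindex n,
    beta a b N =
      \sum_(j : {dffun forall r : 'I_n, 'I_(N r).+1})
        B a b N (fun r => j r) * alpha a b (fun r => j r).

Definition B1 (C : numFieldType) (n : nat) (q p : C) (x : 'I_n -> C)
    (a b : C) (k j : mindex n) : C :=
  qpfact q p (b / a) ((mabs k)%:Z - (mabs j)%:Z)
  / (\prod_(r < n) \prod_(s < n)
       qpfact q p (q ^ (1 + (j r)%:Z - (j s)%:Z) * x r / x s)
                  ((k r)%:Z - (j r)%:Z))
  * \prod_(r < n)
      (qpfact q p (b * x r) ((j r)%:Z + (mabs k)%:Z)
       / qpfact q p (a * x r * q) ((k r)%:Z + (mabs j)%:Z)).

Definition wpb_alpha (C : numFieldType) (n : nat) (q p : C) (x : 'I_n -> C)
    (c d a b : C) (k : mindex n) : C :=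
  (\prod_(r < n)
     (theta p (a * x r * q ^+ (k r + mabs k)) / theta p (a * x r)
      * (qpfact q p (a * x r) (mabs k) * qpfact q p (d * x r) (k r)
         / qpfacts q p [:: a * x r * q / c; b * c * d * x r / a] (k r))))
  * (qpfacts q p [:: c; a ^+ 2 * q / (b * c * d)] (mabs k)
     / (qpfact q p (a * q / d) (mabs k)
        * \prod_(r < n) \prod_(s < n) qpfact q p (q * x r / x s) (k r)))
  * (b / a) ^+ mabs k.

Definition wpb_beta (C : numFieldType) (n : nat) (q p : C) (x : 'I_n -> C)
    (c d a b : C) (k : mindex n) : C :=
  qpfacts q p [:: b * c / a; a * q / (c * d)] (mabs k)
  / (qpfact q p (a * q / d) (mabs k)
     * \prod_(r < n) \prod_(s < n) qpfact q p (q * x r / x s) (k r))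
  * \prod_(r < n)
      (qpfact q p (b * x r) (mabs k) * qpfact q p (b * d * x r / a) (k r)
       / qpfacts q p [:: a * x r * q / c; b * c * d * x r / a] (k r)).

(* The nonvanishing of every factor in a denominator of wpb_alpha, of wpb_beta,
   and of the entries of B1 that occur in WP_Bailey_pair (those with j <= k
   componentwise). *)
Definition denominators_nonzero (C : numFieldType) (n : nat) (q p : C)
    (x : 'I_n -> C) (c d a b : C) : Prop :=
  [/\ forall r : 'I_n, theta p (a * x r) != 0,
      forall (r : 'I_n) (m : nat),
        [/\ qpfact q p (a * x r * q / c) m != 0,
            qpfact q p (b * c * d * x r / a) m != 0
          & qpfact q p (a * x r * q) m != 0],
      forall m : nat, qpfact q p (a * q / d) m != 0,
      forall (r s : 'I_n) (m : nat), qpfact q p (q * x r / x s) m != 0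
    & forall (k j : mindex n), (forall r, (j r <= k r)%N) ->
        forall r s : 'I_n,
          qpfact q p (q ^ (1 + (j r)%:Z - (j s)%:Z) * x r / x s)
                     ((k r)%:Z - (j r)%:Z) != 0].

(* Main.v *)
Require Import Defs.
From mathcomp Require Import all_boot all_order all_algebra.
From mathcomp Require Import boolp classical_sets functions.
From mathcomp Require Import topology normedtype sequences.
From mathcomp Require Import ring zify.
Set Implicit Arguments.
Unset Strict Implicit.
Unset Printing Implicit Defensive.
Import Order.TTheory GRing.Theory Num.Theory.
Import numFieldNormedType.Exports.
Local Open Scope classical_set_scope.
Local Open Scope complex_scope.
Local Open Scope ring_scope.

(** The asserted identity is the elliptic Jackson summation for the root system
    A_n, in the variables a, c, d and lam = b / a. Its proof has three layers.

    Subsets. Suppose first that all N_r equal 1, and write z_1, ..., z_m for the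
    x_r. The sum then runs over the subsets S of a finite set A and, with
    denominators cleared, every term is a product of m factors
    theta(c u) theta(kap u / c) in the parameter c, where kap = a q / (lam d) does
    not depend on c. Such factors lie in a space of dimension 2, so both
    sides are binary forms of degree m in c, and it suffices to compare them at
    m + 1 projectively distinct points. At c = 1 only the empty subset
    contributes. At c = a z_r q only the subsets containing r contribute, and the
    sum collapses to the same sum for A minus r, with a replaced by a q. This
    is an induction on m (jackson_nondegenerate, resting on
    theta_form_interpolation, jackson_term_reduce and jackson_value_reduce).

    The m + 1 points are distinct only if some products lam d z_r and
    a lam d z_r z_s q^k are not zeros of theta. Multiplying lam by a number of
    modulus 1 close to 1 destroys such coincidences, because the zeros of theta are
    the powers of p and have distinct moduli; the general case follows by
    continuity (jackson_subset).

    Clusters. For general N, the subset identity is applied to the |N| numbers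
    x_r q^i with i < N_r. The cross factor of a term contains theta(1) = 0 unless
    S meets each cluster in an initial segment, so subsets are replaced by tuples
    k <= N (jackson_cells), and the products over clusters telescope to
    the entries of the matrix times alpha (B1_alpha_jackson) and to beta
    (beta_jackson).

    Theta functions. The only nontrivial input on theta is that
    theta(x y) theta(x / y) has rank 2 as a function of x and y, which is a form
    of the Weierstrass addition formula (theta_factor_rank2). It is read
    off the triple product: theta(a) is a constant times the sum of
    (-a)^k p^(k (k - 1) / 2) over the integers k (theta_series), and in the double
    series for theta(x y) theta(x / y) the pairs (k, l) split by the parity
    of k + l into (i + j, i - j) and (i + j + 1, i - j), on each of which the
    exponents separate. *)

(** * Completeness of the complex numbers *)

(** Completeness enters only in this form, which lets the sequel be written over an
    abstract numeric field. *)
Definition geo_complete (C : numFieldType) : Prop :=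
  forall (u : nat -> C) (K r : C), 0 <= r -> r < 1 ->
    (forall n, `|u n.+1 - u n| <= K * r ^+ n) -> cvgn u.

Lemma real_geo_complete (R : realType) (v : nat -> R) (K r : R) :
  0 <= r -> r < 1 -> (forall n, `|v n.+1 - v n| <= K * r ^+ n) -> cvgn v.
Proof.
move=> r0 r1 hv.
have -> : v = (fun n => v 0%N + series (telescope v) n).
  apply: funext => n; have /(congr1 (fun f => f n)) /= := telescopeK v.
  by move=> ->; rewrite addrC subrK.
apply: is_cvgD; first exact: is_cvg_cst.
apply: normed_cvg; apply: (series_le_cvg (v_ := geometric K r)) => [n|n|n|].
- exact: normr_ge0.
- exact: le_trans (hv n).
- exact: hv.
- by apply: is_cvg_geometric_series; rewrite ger0_norm.
Qed.

Lemma normC_real (R : rcfType) (x : R) : `|x%:C| = `|x|%:C :> R[i].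
Proof. by rewrite normc_def /= expr0n addr0 sqrtr_sqr. Qed.

(** With the structure as carrier, unification finds the topology in the limits below. *)
Definition complex_numField (R : rcfType) : numFieldType := R[i].

Lemma cvg_real_complex (R : realType) (v : nat -> R) (l : R) :
  v @ \oo --> l -> (fun n => (v n)%:C : complex_numField R) @ \oo --> (l%:C : complex_numField R).
Proof.
move=> /cvgrPdist_lt hv; apply/cvgrPdist_lt => e e0.
have eR : e \is Num.real by rewrite realE ltW.
have e0' : 0 < complex.Re e by rewrite -ltcR RRe_real.
have := hv _ e0'; apply: filterS => n.
by rewrite -ltcR RRe_real // -rmorphB normC_real.
Qed.

Lemma complex_geo_complete (R : realType) : geo_complete R[i].
Proof.
move=> u K r r0 r1 hu.
have K0 : 0 <= K by have := hu 0%N; rewrite expr0 mulr1; apply: le_trans.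
have Kr : (complex.Re K)%:C = K by rewrite RRe_real // realE K0.
have rr : (complex.Re r)%:C = r by rewrite RRe_real // realE r0.
have cvgf (f : R[i] -> R) : {morph f : x y / x - y} ->
    (forall z, `|f z|%:C <= `|z|) -> cvgn (f \o u).
  move=> fB fle; apply: (@real_geo_complete _ _ (complex.Re K) (complex.Re r)).
  - by rewrite -lecR rr.
  - by rewrite -ltcR rr.
  - move=> n; rewrite -lecR rmorphM rmorphXn /= Kr rr -fB.
    exact: le_trans (fle _) (hu n).
have cR : cvgn (fun n => complex.Re (u n)).
  apply: (cvgf (@complex.Re R)) => [[a b] [c d]//|z]; exact: normc_ge_Re.
have cI : cvgn (fun n => complex.Im (u n)).
  apply: (cvgf (@complex.Im R)) => [[a b] [c d]//|z].
  rewrite -normrN -ReiNIm; apply: le_trans (normc_ge_Re _) _.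
  by rewrite normrM (_ : `|'i%C| = 1) ?mulr1 // normc_def /= expr0n add0r expr1n sqrtr1.
rewrite (_ : u = fun n => (complex.Re (u n))%:C + 'i%C * (complex.Im (u n))%:C).
  apply: is_cvgD; last apply: is_cvgM; first last.
  - exact: (cvgP _ (cvg_real_complex cI)).
  - exact: is_cvg_cst.
  - exact: (cvgP _ (cvg_real_complex cR)).
by apply: funext => n; rewrite -complexE.
Qed.

Lemma cvg_num_unique (C : numFieldType) (u : nat -> C) (l m : C) :
  u @ \oo --> l -> u @ \oo --> m -> l = m.
Proof. by move=> ul um; apply: (cvg_unique _ ul um); exact: norm_hausdorff. Qed.

Lemma cvg_seq_ext (C : numFieldType) (u v : nat -> C) (l : C) :
  u =1 v -> u @ \oo --> l -> v @ \oo --> l.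
Proof. by move=> /funext ->. Qed.

(** * Infinite products with geometrically small terms *)

Section InfiniteProducts.
Variable C : numFieldType.
Hypothesis complete : geo_complete C.
Implicit Types (u : nat -> C) (A K r : C).

Lemma cvg_geo r : 0 <= r -> r < 1 -> (fun n => r ^+ n) @ \oo --> (0 : C).
Proof.
move=> r0 r1.
have /cvg_ex [l hl] : cvgn (fun n => r ^+ n).
  apply: (@complete _ (1 - r) r) => // n.
  have d0 : 0 <= 1 - r by rewrite subr_ge0 ltW.
  rewrite exprS -[X in _ - X]mul1r -mulrBl normrM distrC.
  by rewrite !ger0_norm // exprn_ge0.
have hl' : (fun n => r * r ^+ n) @ \oo --> l.
  by rewrite (_ : (fun _ => _) = [sequence r ^+ n.+1]_n) ?cvg_shiftS //;
     apply: funext => n; rewrite /= exprS.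
have e : l = r * l.
  by apply: (cvg_unique _ hl'); [exact: norm_hausdorff | apply: cvgMr].
have : (1 - r) * l = 0 by rewrite mulrBl mul1r -e subrr.
move/eqP; rewrite mulf_eq0 subr_eq0 eq_sym lt_eqF //= => /eqP l0.
by move: hl; rewrite l0.
Qed.

Lemma cvg_geo_le u K r : 0 <= r -> r < 1 ->
  (forall n, `|u n| <= K * r ^+ n) -> u @ \oo --> (0 : C).
Proof.
move=> r0 r1 hu.
have /cvgrPdist_lt h : (fun n => K * r ^+ n) @ \oo --> (0 : C).
  by rewrite -(mulr0 K); apply: cvgMr; apply: cvg_geo.
apply/cvgrPdist_lt => e e0; have := h e e0; apply: filterS => n.
rewrite !sub0r !normrN; apply: le_lt_trans.
by apply: le_trans (hu n) _; apply: real_ler_norm; apply: ger0_real; apply: le_trans (hu n).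
Qed.

Lemma norm_lim_le u (l M : C) : u @ \oo --> l -> (forall n, `|u n| <= M) -> `|l| <= M.
Proof.
move=> /cvgrPdist_lt hl hM.
have M0 : 0 <= M by apply: le_trans (hM 0%N).
rewrite real_leNgt ?ger0_real //; apply/negP => lt.
have /hl [N _ /(_ N (leqnn _)) /=] : 0 < `|l| - M by rewrite subr_gt0.
rewrite ltrBrDr => /(le_lt_trans _) => /(_ `|l|); rewrite ltxx => f.
suff : `|l| <= `|l - u N| + M by move/f.
by apply: le_trans (lerD (lexx _) (hM N)); rewrite -{1}(subrK (u N) l) ler_normD.
Qed.

(** A tail of the product stays below 2: if s is a partial sum of A r^j, bounded by
    1/2, then the corresponding partial product is at most 1 / (1 - s). *)
Lemma prod_geo_bounded A r : 0 <= A -> 0 <= r -> r < 1 ->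
  exists U : C, forall n, \prod_(0 <= j < n) (1 + A * r ^+ j) <= U.
Proof.
move=> A0 r0 r1.
have d0 : 0 < 1 - r by rewrite subr_gt0.
have /cvgrPdist_lt h : (fun n => (A / (1 - r)) * r ^+ n) @ \oo --> (0 : C).
  by rewrite -(mulr0 (A / (1 - r))); apply: cvgMr; apply: cvg_geo.
have h2 : 0 < 2^-1 :> C by rewrite invr_gt0 ltr0n.
have [N _ hN] := h _ h2.
have {hN}hN : A / (1 - r) * r ^+ N <= 2^-1.
  have := hN N (leqnn _); rewrite /= sub0r normrN => /ltW; apply: le_trans.
  by rewrite real_ler_norm // ger0_real // mulr_ge0 ?exprn_ge0 // divr_ge0 // ltW.
have ge1 j : 1 <= 1 + A * r ^+ j by rewrite lerDl mulr_ge0 // exprn_ge0.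
have pos m n : 0 <= \prod_(m <= j < n) (1 + A * r ^+ j).
  by apply: prodr_ge0 => j _; apply: le_trans (ge1 j).
have mono m k : \prod_(0 <= j < m) (1 + A * r ^+ j) <=
    \prod_(0 <= j < m + k) (1 + A * r ^+ j).
  elim: k => [|k IH]; first by rewrite addn0.
  by rewrite addnS big_nat_recr //=; apply: le_trans IH _; rewrite ler_peMr.
pose s k := A / (1 - r) * r ^+ N * (1 - r ^+ k).
have s0 k : 0 <= s k.
  rewrite /s mulr_ge0 // ?subr_ge0 ?exprn_ile1 ?(ltW r1) //.
  by rewrite mulr_ge0 ?exprn_ge0 // divr_ge0 // ltW.
have s2 k : s k <= 2^-1.
  apply: le_trans hN; rewrite /s; apply: ler_piMr; last by rewrite gerBl exprn_ge0.
  by rewrite mulr_ge0 ?exprn_ge0 // divr_ge0 // ltW.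
have sS k : s k.+1 = s k + A * r ^+ (N + k).
  by rewrite /s exprS exprD; field; rewrite gt_eqF.
(* (1 + x) (1 - s - x) <= 1 - s for s, x >= 0 *)
have key k : \prod_(N <= j < N + k) (1 + A * r ^+ j) * (1 - s k) <= 1.
  elim: k => [|k IH].
    by rewrite addn0 big_geq // mul1r gerBl.
  rewrite addnS big_nat_recr ?leq_addr //=; apply: le_trans IH.
  rewrite -mulrA ler_wpM2l //; set x := A * r ^+ (N + k).
  have x0 : 0 <= x by rewrite mulr_ge0 ?exprn_ge0.
  rewrite sS -/x (_ : _ * _ = 1 - s k - x * (s k + x)); last by ring.
  by rewrite gerBl mulr_ge0 // addr_ge0.
exists (2 * \prod_(0 <= j < N) (1 + A * r ^+ j)) => n.
apply: le_trans (mono n N) _; rewrite addnC (big_cat_nat (n := N)) ?leq_addr //=.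
rewrite mulrC ler_wpM2r //.
have := key n; rewrite mulrC -ler_pdivlMl ?div1r; last first.
  by rewrite subr_gt0; apply: le_lt_trans (s2 n) _; rewrite invf_lt1 ?ltr1n ?ltr0n.
rewrite mulr1 => /le_trans; apply; rewrite invf_ple ?posrE ?ltr0n //.
  by rewrite lerBrDl -lerBrDr; apply: le_trans (s2 n) _; rewrite (_ : 1 - 2^-1 = 2^-1 :> C) //; field.
by rewrite subr_gt0; apply: le_lt_trans (s2 n) _; rewrite invf_lt1 ?ltr1n ?ltr0n.
Qed.

Lemma norm_prod1B_bounded u A r : 0 <= r -> r < 1 ->
  (forall j, `|u j| <= A * r ^+ j) ->
  exists2 U : C, 0 <= U & forall n, `|\prod_(0 <= j < n) (1 - u j)| <= U.
Proof.
move=> r0 r1 hu.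
have A0 : 0 <= A by have := hu 0%N; rewrite expr0 mulr1; apply: le_trans.
have [U hU] := prod_geo_bounded A0 r0 r1; exists U.
  by have := hU 0%N; rewrite big_geq //; apply: le_trans.
move=> n; apply: le_trans (hU n); rewrite normr_prod; apply: ler_prod => j _.
by rewrite normr_ge0; apply: le_trans (ler_normB _ _) _; rewrite normr1 lerD2l.
Qed.

Lemma cvg_prod1B u A r : 0 <= r -> r < 1 -> (forall j, `|u j| <= A * r ^+ j) ->
  cvgn (fun n => \prod_(0 <= j < n) (1 - u j)).
Proof.
move=> r0 r1 hu; have [U U0 hU] := norm_prod1B_bounded r0 r1 hu.
apply: (@complete _ (U * A) r) => // n.
rewrite big_nat_recr //= mulrBr mulr1 addrAC subrr add0r normrN normrM -mulrA.
by apply: ler_pM.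
Qed.

(** No factor is close to zero far out, so the inverses of the factors are again
    of the form 1 - v j with v geometrically small, and the inverses of the
    partial products stay bounded. *)
Lemma lim_prod1B_neq0 u A r : 0 <= r -> r < 1 ->
  (forall j, `|u j| <= A * r ^+ j) -> (forall j, 1 - u j != 0) ->
  limn (fun n => \prod_(0 <= j < n) (1 - u j)) != 0.
Proof.
move=> r0 r1 hu hn.
have A0 : 0 <= A by have := hu 0%N; rewrite expr0 mulr1; apply: le_trans.
have /cvgrPdist_lt h := cvg_geo_le r0 r1 hu.
have h2 : 0 < 2^-1 :> C by rewrite invr_gt0 ltr0n.
have [N _ hN] := h _ h2.
pose D : C := 2 + \sum_(0 <= j < N) `|(1 - u j)^-1|.
have D0 : 0 <= D by rewrite addr_ge0 ?sumr_ge0.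
have hD j : `|(1 - u j)^-1| <= D.
  have [ltj|lej] := ltnP j N.
    rewrite /D (bigD1_seq j) ?mem_index_iota ?iota_uniq //=.
    by rewrite addrCA lerDl addr_ge0 ?sumr_ge0.
  have := hN j lej; rewrite /= sub0r normrN => /ltW uj.
  apply: le_trans (_ : 2 <= D); last by rewrite lerDl sumr_ge0.
  rewrite normfV invf_ple ?posrE ?normr_gt0 ?ltr0n //.
  apply: le_trans (lerB_dist _ _); rewrite normr1 lerBrDl -lerBrDr.
  by apply: le_trans uj _; rewrite (_ : 1 - 2^-1 = 2^-1 :> C) //; field.
have hv j : `|- (u j / (1 - u j))| <= D * A * r ^+ j.
  rewrite normrN normrM mulrC -mulrA; exact: ler_pM.
have [U U0 hU] := norm_prod1B_bounded r0 r1 hv.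
have hc := cvg_prod1B r0 r1 hu.
apply/eqP => l0; move: hc; rewrite /= => /cvgrPdist_lt hc.
have e0 : 0 < (U + 1)^-1 by rewrite invr_gt0 ltr_wpDl.
have [M _ hM] := hc _ e0; have := hM M (leqnn _); rewrite /= l0 sub0r normrN.
apply/negP; rewrite -real_leNgt ?ger0_real ?invr_ge0 ?addr_ge0 //.
have := hU M; rewrite (eq_bigr (fun j => (1 - u j)^-1)) => [|j _]; last first.
  by field; apply: hn.
rewrite prodfV normfV => hle; rewrite invf_ple ?posrE ?ltr_wpDl //.
  by apply: le_trans hle _; rewrite lerDl.
by rewrite normr_gt0 prodf_seq_neq0; apply/allP => j _; rewrite hn implybT.
Qed.

Lemma lipschitz_prod1B (p : C) (A : C) : `|p| < 1 ->
  exists L : C, forall (a b : C) n, `|a| <= A -> `|b| <= A ->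
    `|\prod_(0 <= j < n) (1 - a * p ^+ j) - \prod_(0 <= j < n) (1 - b * p ^+ j)|
    <= L * `|a - b|.
Proof.
move=> p1; have [A0|nA0] := boolP (0 <= A); last first.
  by exists 0 => a b n /(le_trans (normr_ge0 _)); rewrite (negPf nA0).
have [U hU] := prod_geo_bounded A0 (normr_ge0 p) p1.
have d0 : 0 < 1 - `|p| by rewrite subr_gt0.
have pos n : 0 <= \prod_(0 <= j < n) (1 + A * `|p| ^+ j).
  by apply: prodr_ge0 => j _; rewrite addr_ge0 ?mulr_ge0 ?exprn_ge0.
have U0 : 0 <= U by apply: le_trans (hU 0%N).
exists (U * (1 - `|p|)^-1) => a b n ha hb.
pose S n := \sum_(0 <= j < n) `|p| ^+ j.
have S0 m : 0 <= S m by apply: sumr_ge0 => j _; rewrite exprn_ge0.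
have hS m : S m <= (1 - `|p|)^-1.
  rewrite -[leRHS]mul1r ler_pdivlMr // (_ : S m * _ = 1 - `|p| ^+ m).
    by rewrite gerBl exprn_ge0.
  rewrite /S; elim: m => [|m IH]; first by rewrite big_geq // mul0r expr0 subrr.
  by rewrite big_nat_recr //= mulrDl IH exprS; ring.
have fac c m : `|c| <= A -> `|1 - c * p ^+ m| <= 1 + A * `|p| ^+ m.
  move=> hc; apply: le_trans (ler_normB _ _) _.
  by rewrite normr1 lerD2l normrM normrX ler_wpM2r ?exprn_ge0.
have pb m : `|\prod_(0 <= j < m) (1 - b * p ^+ j)| <= \prod_(0 <= j < m) (1 + A * `|p| ^+ j).
  by rewrite normr_prod; apply: ler_prod => j _; rewrite normr_ge0 fac.
suff key : `|\prod_(0 <= j < n) (1 - a * p ^+ j) - \prod_(0 <= j < n) (1 - b * p ^+ j)|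
    <= \prod_(0 <= j < n) (1 + A * `|p| ^+ j) * S n * `|a - b|.
  by apply: le_trans key _; rewrite ler_wpM2r // ler_pM.
elim: n => [|n IH].
  by rewrite !big_geq // subrr normr0 mulr_ge0 // mulr_ge0 // ?ler01 // /S big_geq.
rewrite /S !big_nat_recr //= -/(S n).
set Pa := \prod_(_ <= _ < _) _ in IH *; set Pb := \prod_(_ <= _ < _) _ in IH *.
set W := \prod_(_ <= _ < _) _ in IH *.
have -> : Pa * (1 - a * p ^+ n) - Pb * (1 - b * p ^+ n) =
  (Pa - Pb) * (1 - a * p ^+ n) - Pb * p ^+ n * (a - b) by ring.
apply: le_trans (ler_normB _ _) _; rewrite !normrM normrX.
apply: le_trans (_ : W * S n * `|a - b| * (1 + A * `|p| ^+ n) + W * `|p| ^+ n * `|a - b| <= _).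
  apply: lerD; first by apply: ler_pM => //; exact: fac.
  by rewrite ler_wpM2r // ler_wpM2r ?exprn_ge0 //; exact: pb.
rewrite -subr_ge0 (_ : _ - _ = W * `|p| ^+ n * `|a - b| * (A * `|p| ^+ n)); last by ring.
by rewrite !mulr_ge0 ?exprn_ge0 //; apply: pos.
Qed.

End InfiniteProducts.

(** * The theta function: symmetry, zeros, continuity *)

Section ThetaBasics.
Variable C : numFieldType.
Hypothesis complete : geo_complete C.
Variable p : C.
Hypothesis p_lt1 : `|p| < 1.
Implicit Types (a : C) (u : nat -> C).

Definition pochinf a : C := limn (fun n => \prod_(0 <= j < n) (1 - a * p ^+ j)).

Let geo_bound a j : `|a * p ^+ j| <= `|a| * `|p| ^+ j.
Proof. by rewrite normrM normrX. Qed.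

Lemma cvg_pochinf_prod a :
  (fun n => \prod_(0 <= j < n) (1 - a * p ^+ j)) @ \oo --> pochinf a.
Proof. exact: (cvg_prod1B complete (normr_ge0 p) p_lt1 (geo_bound a)). Qed.
Arguments cvg_pochinf_prod a : clear implicits.

Lemma pochinf_neq0 a : (forall j, 1 - a * p ^+ j != 0) -> pochinf a != 0.
Proof. exact: (lim_prod1B_neq0 complete (normr_ge0 p) p_lt1 (geo_bound a)). Qed.

Lemma pochinfS a : pochinf a = (1 - a) * pochinf (a * p).
Proof.
apply: (@cvg_num_unique _ (fun n =>
    (1 - a) * \prod_(0 <= j < n) (1 - a * p * p ^+ j))); last first.
  by apply: cvgMr; exact: cvg_pochinf_prod.
have := cvg_pochinf_prod a; rewrite -cvg_shiftS; apply: cvg_seq_ext => n /=.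
rewrite big_nat_recl //= expr0 mulr1; congr (_ * _).
by apply: eq_bigr => j _; rewrite exprS mulrA.
Qed.

Lemma cvg_pochinf u (l : C) : u @ \oo --> l -> (fun n => pochinf (u n)) @ \oo --> pochinf l.
Proof.
move=> ul; have /cvgrPdist_lt h := ul.
have [N0 _ hN0] := h 1 ltr01.
have [L hL] := lipschitz_prod1B complete (`|l| + 1) p_lt1.
have hlip (a : C) : `|a| <= `|l| + 1 -> `|pochinf l - pochinf a| <= L * `|l - a|.
  move=> ha; apply: norm_lim_le (cvgB (cvg_pochinf_prod l) (cvg_pochinf_prod a)) _ => n /=.
  by apply: hL => //; rewrite lerDl.
have h0 : (fun n => L * `|l - u n|) @ \oo --> (0 : C).
  rewrite -(mulr0 L); apply: cvgMr; rewrite -(normr0 C) -(subrr l).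
  by apply: cvg_norm; apply: cvgB => //; exact: cvg_cst.
apply/cvgrPdist_lt => e e0.
have /cvgrPdist_lt /(_ e e0) [N1 _ hN1] := h0.
exists (maxn N0 N1) => // n /=; rewrite geq_max => /andP[n0 n1].
have := hN1 n n1; rewrite /= sub0r normrN.
have ha : `|u n| <= `|l| + 1.
  have := hN0 n n0; rewrite /= => /ltW d; rewrite -{1}(subrK l (u n)) addrC.
  by apply: le_trans (ler_normD _ _) _; rewrite lerD2l distrC.
apply: le_lt_trans; apply: le_trans (hlip _ ha) _.
by apply: real_ler_norm; apply: ger0_real; apply: le_trans (hlip _ ha).
Qed.

Lemma cvg_theta_prod a :
  (fun m => \prod_(0 <= j < m) ((1 - a * p ^+ j) * (1 - p ^+ j.+1 / a))) @ \oo
    --> pochinf a * pochinf (p / a).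
Proof.
apply: cvg_seq_ext (cvgM (cvg_pochinf_prod a) (cvg_pochinf_prod (p / a))) => n /=.
rewrite -big_split /=.
by apply: eq_bigr => j _; rewrite exprS mulrAC.
Qed.
Arguments cvg_theta_prod a : clear implicits.

Lemma thetaE a : theta p a = pochinf a * pochinf (p / a).
Proof. by apply: cvg_lim (cvg_theta_prod a); exact: norm_hausdorff. Qed.

Lemma theta1 : theta p 1 = 0.
Proof. by rewrite thetaE pochinfS subrr !mul0r. Qed.

(** Taking one factor out of each product turns the two products for 1 / a into those
    for a. *)
Lemma thetaV a : a != 0 -> theta p a^-1 = - theta p a / a.
Proof.
move=> a0; rewrite !thetaE invrK [pochinf a]pochinfS [pochinf a^-1]pochinfS.
by rewrite ![p * _]mulrC; field.
Qed.

Lemma cvg_theta u (l : C) : l != 0 -> u @ \oo --> l ->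
  (fun n => theta p (u n)) @ \oo --> theta p l.
Proof.
move=> l0 ul; rewrite thetaE.
rewrite (_ : (fun n => _) = (fun n => pochinf (u n)) \* (fun n => pochinf (p / u n))).
  apply: cvgM; first exact: cvg_pochinf.
  by apply: cvg_pochinf; apply: cvgMr; apply: cvgV.
by apply: funext => n; rewrite thetaE.
Qed.

Lemma theta_eq0 a : a != 0 -> theta p a = 0 ->
  exists j, a * p ^+ j = 1 \/ a = p ^+ j.+1.
Proof.
move=> a0 /eqP; rewrite thetaE; apply: contraTP => hn.
rewrite mulf_neq0 //; apply: pochinf_neq0 => j; rewrite subr_eq0; apply/eqP => e.
  by apply: hn; exists j; left.
apply: hn; exists j; right.
by apply: (mulIf (invr_neq0 a0)); rewrite mulfV // exprS mulrAC.
Qed.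

Lemma norm_exp_inj i j : `|p| ^+ i = `|p| ^+ j -> p ^+ i = p ^+ j.
Proof.
have [->|p0] := eqVneq p 0.
  rewrite normr0 !expr0n => h; congr (_%:R); apply/eqP.
  by rewrite -(eqr_nat C) h.
have inj : injective (fun n => `|p| ^+ n).
  move=> m n /eqP; apply: contraTeq => /=; rewrite neq_ltn => /orP[] lt.
  - by rewrite gt_eqF // ltr_iXn2l // normr_gt0.
  - by rewrite lt_eqF // ltr_iXn2l // normr_gt0.
by move/inj => ->.
Qed.

(** The zeros of theta are integral powers of p, whose moduli are distinct, so no
    circle about 0 contains two of them. *)
Lemma theta_circle_zero a v : a != 0 -> `|v| = 1 ->
  theta p a = 0 -> theta p (a * v) = 0 -> v = 1.
Proof.
move=> a0 v1 za zav.
have v0 : v != 0 by rewrite -normr_gt0 v1.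
have [i hi] := theta_eq0 a0 za.
have [j hj] := theta_eq0 (mulf_neq0 a0 v0) zav.
have sm k : v = p ^+ k.+1 -> v = 1.
  move=> e; suff : `|v| < 1 by rewrite v1 ltxx.
  by rewrite e normrX exprn_ilt1.
case: hi => hi; case: hj => hj.
- have e : `|p| ^+ i = `|p| ^+ j.
    apply: (@mulfI _ `|a|); first by rewrite normr_eq0.
    have e : `|a * p ^+ j| * `|v| = 1 by rewrite -normrM mulrAC hj normr1.
    by rewrite -!normrX -!normrM hi normr1 -e v1 mulr1.
  by rewrite -hj -(norm_exp_inj e) mulrAC hi mul1r.
- apply: (sm (i + j)%N); rewrite -[LHS]mul1r -hi mulrAC hj -exprD; congr (_ ^+ _).
  by rewrite addSn addnC.
- exfalso; have : `|a * v * p ^+ j| < 1.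
    by rewrite hi mulrAC -exprD normrM normrX v1 mulr1 exprn_ilt1.
  by rewrite hj normr1 ltxx.
- have e : `|p| ^+ i.+1 = `|p| ^+ j.+1 by rewrite -!normrX -hi -hj normrM v1 mulr1.
  by apply: (mulfI a0); rewrite hj -(norm_exp_inj e) -hi mulr1.
Qed.

End ThetaBasics.
Arguments cvg_pochinf_prod {C} complete {p} p_lt1 a.
Arguments cvg_theta_prod {C} complete {p} p_lt1 a.

(** * The q-binomial theorem *)

Section FiniteTripleProduct.
Variable C : numFieldType.
Variable p : C.
Hypothesis p_lt1 : `|p| < 1.
Implicit Types (a z : C) (n m i : nat) (k : int).

Definition qfac n : C := \prod_(0 <= j < n) (1 - p * p ^+ j).

Lemma expp_neq1 n : 1 - p * p ^+ n != 0.
Proof.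
rewrite subr_eq0 -exprS; apply/eqP => e.
suff : `|p ^+ n.+1| < 1 by rewrite -e normr1 ltxx.
by rewrite normrX exprn_ilt1.
Qed.

Lemma qfac_neq0 n : qfac n != 0.
Proof. by rewrite /qfac prodf_seq_neq0; apply/allP => j _; rewrite expp_neq1 implybT. Qed.

Lemma qfacS n : qfac n.+1 = qfac n * (1 - p ^+ n.+1).
Proof. by rewrite /qfac big_nat_recr //= exprS. Qed.

Lemma onem_neq0 n : 1 - p ^+ n.+1 != 0.
Proof. by rewrite exprS expp_neq1. Qed.

Definition gbin n i : C := qfac n / (qfac i * qfac (n - i)).

Lemma qfac0 : qfac 0 = 1.
Proof. by rewrite /qfac big_geq. Qed.

Lemma gbinn0 n : gbin n 0 = 1.
Proof. by rewrite /gbin subn0 qfac0 mul1r divff // qfac_neq0. Qed.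

Lemma gbinnn n : gbin n n = 1.
Proof. by rewrite /gbin subnn qfac0 mulr1 divff // qfac_neq0. Qed.

Lemma gbin_pascal n i : (i < n)%N ->
  gbin n.+1 i.+1 = gbin n i.+1 + p ^+ (n - i) * gbin n i.
Proof.
move=> lt; rewrite /gbin subSS !qfacS.
have [d ->] : exists d, n = (i + d.+1)%N by exists (n - i.+1)%N; lia.
rewrite (_ : i + d.+1 - i = d.+1)%N; last by lia.
rewrite (_ : i + d.+1 - i.+1 = d)%N; last by lia.
rewrite qfacS (_ : p ^+ (i + d.+1).+1 = p ^+ i.+1 * p ^+ d.+1); last by rewrite -exprD addSn.
by field; rewrite !qfac_neq0 !onem_neq0.
Qed.

Lemma qbinomial n z :
  \prod_(0 <= j < n) (1 + z * p ^+ j) =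
  \sum_(0 <= i < n.+1) p ^+ 'C(i, 2) * gbin n i * z ^+ i.
Proof.
elim: n => [|n IH]; first by rewrite big_geq // big_nat1 gbinn0 !mulr1.
rewrite big_nat_recr //= IH mulrDr mulr1 [RHS]big_nat_recl // [in RHS]big_nat_recr //=.
rewrite [X in X + _ = _]big_nat_recl // [X in _ + X * _ = _]big_nat_recr //=.
rewrite mulrDl !gbinn0 !gbinnn -!addrA; congr (_ + _); rewrite !addrA; congr (_ + _); last first.
  by rewrite binS bin1 exprD exprS; ring.
rewrite mulr_suml -big_split /=; apply: eq_big_nat => i /andP[_ lt].
rewrite gbin_pascal // binS bin1 exprD exprS.
rewrite -[in z * p ^+ n](subnK (ltnW lt)) exprD; ring.
Qed.

End FiniteTripleProduct.

(** * Theta-like sums over the integers *)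

(** Defined by recursion so that a symmetric partial sum exceeds the previous one by
    two terms. *)
Fixpoint zrange (M : nat) : seq int :=
  if M is m.+1 then Posz m.+1 :: Negz m :: zrange m else [:: 0].

Lemma mem_zrange M (k : int) : (k \in zrange M) = (`|k| <= M)%N.
Proof.
elim: M => [|M IH] /=; first by rewrite inE; lia.
by rewrite !inE IH; lia.
Qed.

Lemma uniq_zrange M : uniq (zrange M).
Proof. by elim: M => //= M ->; rewrite !inE !mem_zrange andbT /=; lia. Qed.

Lemma big_zrange_shift (V : nmodType) M (F : int -> V) :
  \sum_(0 <= i < M.*2.+1) F (i%:Z - M%:Z) = \sum_(k <- zrange M) F k.
Proof.
rewrite -(big_map (fun i : nat => i%:Z - M%:Z) xpredT F); apply: perm_big.
apply: uniq_perm; rewrite ?uniq_zrange //.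
  by rewrite map_inj_uniq ?iota_uniq // => i j; lia.
move=> k; rewrite mem_zrange; apply/mapP/idP => [[j] | le].
  by rewrite mem_index_iota => /andP[_ lt] ->; lia.
by exists (absz (k + M%:Z)); rewrite ?mem_index_iota; lia.
Qed.

(** The exponent k (k - 1) / 2 of the theta series. *)
Definition tri (k : int) : nat := match k with Posz n => 'C(n, 2) | Negz n => 'C(n.+2, 2) end.

Lemma bin2_double (n : nat) : ('C(n, 2) * 2 = n * n.-1)%N.
Proof. by elim: n => // n IH; rewrite binS bin1 mulnDl IH; case: n {IH} => // n; rewrite /=; nia. Qed.

Lemma tri_double (k : int) : (tri k)%:Z * 2 = k * (k - 1).
Proof. by case: k => n /=; [have := bin2_double n | have := bin2_double n.+2]; case: n => [|n] /=; nia. Qed.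

Lemma tri_ge (k : int) : ('C(`|k|, 2) <= tri k)%N.
Proof. by case: k => n //=; rewrite binS leq_addr. Qed.

Lemma le_bin2_sqr (n : nat) : ('C(n, 2) <= n ^ 2)%N.
Proof. by have := bin2_double n; case: n => [|n] /=; nia. Qed.

Section GaussSums.
Variable C : numFieldType.
Hypothesis complete : geo_complete C.
Implicit Types (y : C) (ex : int -> nat).

Definition gsum (ex : int -> nat) (p y : C) (M : nat) : C :=
  \sum_(k <- zrange M) y ^ k * p ^+ ex k.

Lemma gauss_bound (r s : C) : 0 <= r -> r < 1 -> 0 <= s ->
  exists2 K : C, 0 <= K & forall n, r ^+ 'C(n, 2) * s ^+ n <= K * 2^-1 ^+ n.
Proof.
move=> r0 r1 s0.
pose w n := r ^+ 'C(n, 2) * (2 * s) ^+ n.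
have w0 n : 0 <= w n by rewrite mulr_ge0 ?exprn_ge0 // mulr_ge0.
have wS n : w n.+1 = w n * (r ^+ n * (2 * s)).
  by rewrite /w binS bin1 exprD exprS; ring.
have /cvgrPdist_lt h : (fun n => (2 * s) * r ^+ n) @ \oo --> (0 : C).
  by rewrite -(mulr0 (2 * s)); apply: cvgMr; apply: cvg_geo.
have [N _ hN] := h 1 ltr01.
have hNk k : w (N + k)%N <= w N.
  elim: k => [|k IH]; first by rewrite addn0.
  rewrite addnS wS; apply: le_trans IH; apply: ler_piMr => //.
  have := hN (N + k)%N (leq_addr _ _); rewrite /= sub0r normrN mulrC => /ltW.
  by apply: le_trans; rewrite real_ler_norm // ger0_real // !mulr_ge0 ?exprn_ge0.
have hw n : w n <= \sum_(0 <= i < N.+1) w i.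
  have le1 i : (i <= N)%N -> w i <= \sum_(0 <= i < N.+1) w i.
    move=> le; rewrite (bigD1_seq i) ?mem_index_iota ?iota_uniq //=.
    by rewrite lerDl sumr_ge0.
  have [le|lt] := leqP n N; first exact: le1.
  by rewrite -(subnKC (ltnW lt)); apply: le_trans (hNk _) (le1 _ _).
exists (\sum_(0 <= i < N.+1) w i); first by rewrite sumr_ge0.
move=> n; have := hw n; rewrite /w exprMn_comm; last exact: mulrC.
rewrite -[X in _ -> _ <= X * _]mulr1 => h2.
rewrite exprVn ler_pdivlMr ?exprn_gt0 ?ltr0n // mulr1.
by rewrite mulrAC -mulrA.
Qed.

(** A quadratic exponent makes the terms decay faster than any geometric sequence,
    even against the weight s^|k|; the ratio 1/2 is an arbitrary choice. *)
Lemma gauss_term_bound ex p y : `|p| < 1 -> y != 0 ->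
  (forall k, 'C(`|k|, 2) <= ex k)%N ->
  forall s : C, 0 <= s -> exists2 K : C, 0 <= K &
    forall k, `|y ^ k * p ^+ ex k| * s ^+ `|k|%N <= K * 2^-1 ^+ `|k|%N.
Proof.
move=> p1 y0 hex s s0; pose r := `|y| + `|y|^-1.
have r0 : 0 <= r by rewrite addr_ge0 ?invr_ge0.
have [K K0 hK] := gauss_bound (normr_ge0 p) p1 (mulr_ge0 r0 s0).
exists K => // k; apply: le_trans (hK `|k|%N).
rewrite normrM normrX exprMn_comm; last exact: mulrC.
rewrite mulrA ler_wpM2r ?exprn_ge0 // mulrC.
apply: ler_pM; rewrite ?exprn_ge0 //; first by rewrite ler_wiXn2l // ltW.
case: k => n.
  by rewrite -exprnP normrX lerXn2r ?nnegrE // lerDl invr_ge0.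
by rewrite NegzE -exprnN normfV normrX -exprVn lerXn2r ?nnegrE ?invr_ge0 // lerDr.
Qed.

Lemma cvg_zrange_sum (u : int -> C) K :
  (forall k, `|u k| <= K * 2^-1 ^+ `|k|%N) ->
  cvgn (fun M => \sum_(k <- zrange M) u k).
Proof.
move=> hu; have K0 : 0 <= K by have := hu 0; rewrite expr0 mulr1; apply: le_trans.
apply: (@complete _ K 2^-1); rewrite ?invr_ge0 ?invf_lt1 ?ltr1n //.
move=> n /=; rewrite !big_cons addrA addrK; apply: le_trans (ler_normD _ _) _.
apply: le_trans (lerD (hu _) (hu _)) _; rewrite /= exprS -mulrDl.
by move: (2^-1 ^+ n) => h; rewrite le_eqVlt; apply/orP; left; apply/eqP; field.
Qed.

Lemma sum_half_zrange M : \sum_(k <- zrange M) (2^-1 : C) ^+ `|k|%N <= 3.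
Proof.
suff -> : \sum_(k <- zrange M) (2^-1 : C) ^+ `|k|%N = 3 - 2 * 2^-1 ^+ M.
  by rewrite gerBl mulr_ge0 // exprn_ge0 // invr_ge0.
elim: M => [|M IH]; first by rewrite big_seq1 /= expr0; ring.
by rewrite /= !big_cons IH /= exprS; field.
Qed.

Lemma cvg_gsum ex p y : `|p| < 1 -> y != 0 ->
  (forall k, 'C(`|k|, 2) <= ex k)%N -> gsum ex p y @ \oo --> limn (gsum ex p y).
Proof.
move=> p1 y0 hex; have [K K0 hK] := gauss_term_bound p1 y0 hex (@ler01 C).
by apply: cvg_zrange_sum => k; have := hK k; rewrite expr1n mulr1; apply.
Qed.

End GaussSums.

(** * The triple product *)

Section TripleProduct.
Variable C : numFieldType.
Hypothesis complete : geo_complete C.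
Variable p : C.
Hypothesis p_lt1 : `|p| < 1.
Hypothesis p_neq0 : p != 0.

Lemma prod_scaled_powers (a : C) m :
  \prod_(0 <= j < m) (a / p ^+ j.+1) = a ^+ m / p ^+ 'C(m.+1, 2).
Proof.
elim: m => [|m IH]; first by rewrite big_geq // expr0 divr1.
rewrite big_nat_recr //= IH [in RHS]binS bin1 exprD !exprS.
by field; rewrite ?p_neq0 ?expf_neq0.
Qed.

(** The q-binomial theorem at z = - a p^(-m) with 2 m factors: half of the factors are
    1 - a p^j and the other half are multiples of 1 - p^(j+1) / a. *)
Lemma finite_triple_product (a : C) m : a != 0 ->
  \prod_(0 <= j < m) ((1 - a * p ^+ j) * (1 - p ^+ j.+1 / a)) =
  \sum_(k <- zrange m) gbin p m.*2 (absz (k + m%:Z)) * ((- a) ^ k * p ^+ tri k).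
Proof.
move=> a0; have na0 : - a != 0 by rewrite oppr_eq0.
pose W := \prod_(0 <= j < m) (- a / p ^+ j.+1).
have W0 : W != 0.
  rewrite /W prodf_seq_neq0; apply/allP => j _.
  by rewrite mulf_neq0 ?implybT // invr_neq0 // expf_neq0.
apply: (mulfI W0).
have := qbinomial p_lt1 m.*2 (- a / p ^+ m).
(* the first half is reversed, so that its j-th factor carries p^(-j-1) *)
have sp (F : nat -> C) : \prod_(0 <= j < m.*2) F j =
    (\prod_(0 <= j < m) F (m - j.+1)%N) * \prod_(0 <= j < m) F (j + m)%N.
  rewrite -addnn (big_cat_nat (n := m)) ?leq_addr //=; congr (_ * _).
    by rewrite big_nat_rev.
  by rewrite -{1}[m]add0n big_addn addnK.
rewrite sp.
rewrite (_ : \prod_(0 <= j < m) _ * _ = W * \prod_(0 <= j < m) ((1 - a * p ^+ j) * (1 - p ^+ j.+1 / a))).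
  move->; rewrite mulr_sumr -big_zrange_shift; apply: eq_bigr => i _.
  rewrite subrK /= /W prod_scaled_powers expfzDr // -exprnN -exprnP.
  have e : (tri (i%:Z - m%:Z) + m * i = 'C(i, 2) + 'C(m.+1, 2))%N.
    have := tri_double (i%:Z - m%:Z); have := bin2_double i; have := bin2_double m.+1.
    by case: i => [|i] /=; nia.
  have {}e : p ^+ tri (i%:Z - m%:Z) = p ^+ 'C(i, 2) * p ^+ 'C(m.+1, 2) / p ^+ (m * i).
    by rewrite -exprD -e exprD mulfK // expf_neq0.
  rewrite e expr_div_n -exprM.
  by field; rewrite ?p_neq0 ?na0 ?expf_neq0.
rewrite /W -!big_split /= big_nat [RHS]big_nat; apply: eq_bigr => j /andP[_ lt].
rewrite [p ^+ (_ + _)]exprD (_ : p ^+ m = p ^+ (m - j.+1) * p ^+ j.+1); last by rewrite -exprD subnK.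
by field; rewrite ?p_neq0 ?a0 ?expf_neq0.
Qed.

End TripleProduct.

Section ThetaSeries.
Variable C : numFieldType.
Hypothesis complete : geo_complete C.

Lemma norm_lim_geo (u : nat -> C) (l K r : C) : 0 <= r -> r < 1 ->
  (forall n, `|u n.+1 - u n| <= K * r ^+ n) -> u @ \oo --> l ->
  forall n, `|l - u n| <= K / (1 - r) * r ^+ n.
Proof.
move=> r0 r1 hu ul n.
have K0 : 0 <= K by have := hu 0%N; rewrite expr0 mulr1; apply: le_trans.
have d0 : 0 < 1 - r by rewrite subr_gt0.
apply: (@norm_lim_le _ (fun m => u (m + n)%N - u n)) => [|m].
  apply: cvgB; last exact: cvg_cst.
  by have := ul; rewrite -(cvg_shiftn n); apply: cvg_seq_ext.
apply: le_trans (_ : K / (1 - r) * r ^+ n * (1 - r ^+ m) <= _); last first.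
  by rewrite ler_piMr ?gerBl ?exprn_ge0 // mulr_ge0 ?exprn_ge0 // divr_ge0 // ltW.
elim: m => [|m IH]; first by rewrite add0n subrr normr0 expr0 subrr mulr0.
rewrite addSn -(subrK (u (m + n)%N) (u (m + n).+1)) -addrA.
apply: le_trans (ler_normD _ _) _; apply: le_trans (lerD (hu _) IH) _.
rewrite le_eqVlt; apply/orP; left; apply/eqP; rewrite exprD exprS; field.
by rewrite gt_eqF.
Qed.

Lemma cvg_seq_bounded (u : nat -> C) (l : C) : u @ \oo --> l ->
  exists2 V : C, 0 <= V & forall n, `|u n| <= V.
Proof.
move=> /cvgrPdist_lt h; have [N _ hN] := h 1 ltr01.
exists (`|l| + 1 + \sum_(0 <= i < N) `|u i|) => [|n].
  by rewrite !addr_ge0 // sumr_ge0.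
have [lt|le] := ltnP n N.
  rewrite (bigD1_seq n) ?mem_index_iota ?iota_uniq //= addrCA lerDl.
  by rewrite !addr_ge0 // sumr_ge0.
apply: le_trans (_ : `|l| + 1 <= _); last by rewrite lerDl sumr_ge0.
have := hN n le; rewrite /= => /ltW d; rewrite -{1}(subrK l (u n)) addrC.
by apply: le_trans (ler_normD _ _) _; rewrite lerD2l distrC.
Qed.

Variable p : C.
Hypothesis p_lt1 : `|p| < 1.
Hypothesis p_neq0 : p != 0.

(** All three factors of the Gaussian binomial tend to the infinite product with an
    error of order p^(m - |k|), because their indices are at least m - |k|. *)
Lemma gbin_central_bound : exists2 D : C, 0 <= D & forall m (k : int), (absz k <= m)%N ->
  `|gbin p m.*2 (absz (k + m%:Z)) - (pochinf p p)^-1| <= D * `|p| ^+ (m - absz k).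
Proof.
have hc := cvg_pochinf_prod complete p_lt1 p; set P := pochinf p p in hc *.
have P0 : P != 0 by apply: pochinf_neq0 => // j; exact: expp_neq1.
have [U U0 hU] := cvg_seq_bounded hc.
have [V V0 hV] := cvg_seq_bounded (cvgV P0 hc).
have hUP : `|P| <= U by apply: norm_lim_le hc hU.
have hstep n : `|qfac p n.+1 - qfac p n| <= U * `|p| ^+ n.
  rewrite qfacS mulrBr mulr1 addrAC subrr add0r normrN normrM normrX.
  by apply: ler_pM; [| exact: exprn_ge0 | exact: hU | rewrite ler_wiXn2l // ltW].
have hd := norm_lim_geo (normr_ge0 p) p_lt1 hstep hc.
set D0 := U / (1 - `|p|) in hd.
have D00 : 0 <= D0 by rewrite divr_ge0 // subr_ge0 ltW.
exists (V * V * `|P^-1| * (3 * (U * D0))).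
  apply: mulr_ge0; last by apply: mulr_ge0 => //; apply: mulr_ge0.
  by apply: mulr_ge0 => //; apply: mulr_ge0.
move=> m k lek.
have [i [j [-> ei ej]]] : exists i j, [/\ absz (k + m%:Z) = i, (i + j = m.*2)%N & (m - absz k <= minn i j)%N].
  pose i := absz (k + m%:Z); exists i, (m.*2 - i)%N; rewrite /i; split => //; lia.
set e := (m - absz k)%N in ej *.
rewrite /gbin (_ : m.*2 - i = j)%N; last by lia.
have q0 n : qfac p n != 0 by exact: qfac_neq0.
have -> : qfac p m.*2 / (qfac p i * qfac p j) - P^-1 =
  (qfac p i)^-1 * (qfac p j)^-1 * P^-1 *
  ((P - qfac p i) * P + (P - qfac p j) * qfac p i - (P - qfac p m.*2) * P).
  by field; rewrite P0 !q0.
have hle n : (e <= n)%N -> `|P - qfac p n| <= D0 * `|p| ^+ e.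
  move=> le; apply: le_trans (hd n) _; rewrite ler_wpM2l //.
  by rewrite ler_wiXn2l // ltW.
rewrite -[leRHS]mulrA normrM; apply: ler_pM => //.
  have hV' n : `|(qfac p n)^-1| <= V by exact: hV.
  by rewrite 2!normrM; apply: ler_pM => //; [exact: mulr_ge0 | apply: ler_pM => //; exact: hV'].
rewrite (_ : _ * _ * _ = D0 * `|p| ^+ e * U + D0 * `|p| ^+ e * U + D0 * `|p| ^+ e * U); last by ring.
apply: le_trans (ler_normB _ _) _; apply: lerD.
  apply: le_trans (ler_normD _ _) _; apply: lerD; rewrite normrM; apply: ler_pM => //.
  - by apply: hle; lia.
  - by apply: hle; lia.
  - exact: hU.
rewrite normrM; apply: ler_pM => //; apply: hle; lia.
Qed.

(** Jacobi's triple product, up to the value of the constant. The error at level m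
    is bounded by the sum of p^(m - |k|) times the terms of the series, which is of
    order p^m since the terms decay faster than p^|k|. *)
Lemma theta_series (a : C) : a != 0 ->
  theta p a = (pochinf p p)^-1 * limn (gsum tri p (- a)).
Proof.
move=> a0; have na0 : - a != 0 by rewrite oppr_eq0.
have [D D0 hD] := gbin_central_bound.
have s0 : 0 <= `|p|^-1 by rewrite invr_ge0.
have [K K0 hK] := gauss_term_bound complete p_lt1 na0 tri_ge s0.
have pp : 0 < `|p| by rewrite normr_gt0.
pose th m := \prod_(0 <= j < m) ((1 - a * p ^+ j) * (1 - p ^+ j.+1 / a)).
have h0 : (fun m => th m - (pochinf p p)^-1 * gsum tri p (- a) m) @ \oo --> (0 : C).
  apply: (@cvg_geo_le _ complete _ (D * K * 3) `|p|) => // m.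
  rewrite /th finite_triple_product // /gsum mulr_sumr -sumrB.
  apply: le_trans (ler_norm_sum _ _ _) _.
  apply: le_trans (_ : \sum_(k <- zrange m) D * `|p| ^+ m * K * 2^-1 ^+ absz k <= _); last first.
    rewrite -mulr_sumr (_ : D * K * 3 * _ = D * `|p| ^+ m * K * 3); last by ring.
    apply: ler_wpM2l; last exact: sum_half_zrange.
    by apply: mulr_ge0 => //; apply: mulr_ge0 => //; exact: exprn_ge0.
  rewrite big_seq [leRHS]big_seq; apply: ler_sum => k; rewrite mem_zrange => lek.
  rewrite -mulrBl normrM -[leRHS]mulrA.
  apply: le_trans (ler_pM (normr_ge0 _) (normr_ge0 _) (hD _ _ lek) (lexx _)) _.
  rewrite -[leLHS]mulrA -[leRHS]mulrA ler_wpM2l //.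
  have -> : `|p| ^+ (m - absz k) = `|p| ^+ m * `|p|^-1 ^+ absz k.
    by rewrite -{2}(subnK lek) exprD exprVn mulfK // expf_neq0 // gt_eqF.
  by rewrite -mulrA ler_wpM2l ?exprn_ge0 // mulrC.
have h1 := cvg_gsum complete p_lt1 na0 tri_ge.
have h1' : (fun m => (pochinf p p)^-1 * gsum tri p (- a) m) @ \oo -->
    (pochinf p p)^-1 * limn (gsum tri p (- a)) by apply: cvgMr.
have h2 : (fun m => th m - (pochinf p p)^-1 * gsum tri p (- a) m +
    (pochinf p p)^-1 * gsum tri p (- a) m) @ \oo -->
    (pochinf p p)^-1 * limn (gsum tri p (- a)).
  by rewrite -[X in _ --> X]add0r; apply: cvgD.
have h3 := cvg_theta_prod complete p_lt1 a; rewrite -(thetaE complete p_lt1) in h3.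
apply: cvg_num_unique h3 _; apply: cvg_seq_ext h2 => m /=.
by rewrite subrK.
Qed.

End ThetaSeries.

(** * The addition formula as a rank-two factorization *)

Section LatticeSums.
Variable C : numFieldType.
Implicit Types (M : nat).

(** Summation over the region s2 may be replaced by summation over s1 as soon as the
    absolute sums over s1 and a larger s3 have the same limit. *)
Lemma sum_sandwich (T : eqType) (f : T -> C) (s1 s2 s3 : seq T) :
  uniq s1 -> uniq s2 -> uniq s3 -> {subset s1 <= s2} -> {subset s2 <= s3} ->
  `|\sum_(x <- s2) f x - \sum_(x <- s1) f x|
    <= \sum_(x <- s3) `|f x| - \sum_(x <- s1) `|f x|.
Proof.
move=> u1 u2 u3 s12 s23.
have split_sum (g : T -> C) (s s' : seq T) : uniq s -> uniq s' -> {subset s <= s'} ->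
    \sum_(x <- s') g x = \sum_(x <- s) g x + \sum_(x <- s' | x \notin s) g x.
  move=> us us' ss'; rewrite (bigID (mem s)) /=; congr (_ + _).
  rewrite -big_filter; apply: perm_big; apply: uniq_perm => //.
    exact: filter_uniq.
  by move=> x; rewrite mem_filter andb_idr //; exact: ss'.
rewrite (split_sum f s1 s2) // addrAC subrr add0r.
rewrite (split_sum (fun x => `|f x|) s1 s3) //; last by move=> x /s12 /s23.
rewrite addrAC subrr add0r.
apply: le_trans (_ : \sum_(x <- s2 | x \notin s1) `|f x| <= _).
  exact: ler_norm_sum.
rewrite -big_filter -[leRHS]big_filter.
rewrite [leRHS](split_sum _ [seq x <- s2 | x \notin s1]) ?filter_uniq //.
  by rewrite lerDl sumr_ge0.
by move=> x; rewrite !mem_filter => /andP[-> /s23 ->].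
Qed.

Definition box M : seq (int * int) := [seq (k, l) | k <- zrange M, l <- zrange M].

(** The image of a box under the substitutions (i, j) to (i + j, i - j) and
    (i + j + 1, i - j), which hit each pair exactly once according to the parity
    of its sum. *)
Definition diamond M : seq (int * int) :=
  [seq (i + j, i - j) | i <- zrange M, j <- zrange M] ++
  [seq (i + j + 1, i - j) | i <- zrange M, j <- zrange M].

Lemma uniq_box M : uniq (box M).
Proof. by apply: allpairs_uniq; rewrite ?uniq_zrange // => -[? ?] [? ?]. Qed.

Lemma uniq_diamond M : uniq (diamond M).
Proof.
rewrite cat_uniq; apply/and3P; split.
- apply: allpairs_uniq; rewrite ?uniq_zrange //.
  move=> [i j] [i' j'] _ _ /= [e1 e2]; congr (_, _); lia.
- apply/hasPn => -[k l] /allpairsP [[i j] /= [_ _ [-> ->]]].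
  by apply/negP => /allpairsP [[i' j'] /= [_ _ [e1 e2]]]; lia.
- apply: allpairs_uniq; rewrite ?uniq_zrange //.
  move=> [i j] [i' j'] _ _ /= [e1 e2]; congr (_, _); lia.
Qed.

Lemma mem_box M k l : ((k, l) \in box M) = (absz k <= M)%N && (absz l <= M)%N.
Proof.
rewrite -!mem_zrange; apply/allpairsP/andP => [[[k' l'] /= [hk hl [-> ->]]] // | [hk hl]].
by exists (k, l).
Qed.

Lemma box_sub_diamond M : {subset box M <= diamond M}.
Proof.
move=> [k l]; rewrite mem_box => /andP[hk hl]; rewrite mem_cat.
pose i := ((k + l) %/ 2)%Z.
have [e|e] : k + l = i + i \/ k + l = i + i + 1 by rewrite /i; lia.
- apply/orP; left; apply/allpairsP; exists (i, k - i) => /=.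
  by rewrite !mem_zrange; split; [lia | lia | congr (_, _); lia].
- apply/orP; right; apply/allpairsP; exists (i, k - i - 1) => /=.
  by rewrite !mem_zrange; split; [lia | lia | congr (_, _); lia].
Qed.

Lemma diamond_sub_box M : {subset diamond M <= box M.*2.+1}.
Proof.
move=> [k l]; rewrite mem_cat => /orP[] /allpairsP [[i j] /= [hi hj [-> ->]]];
  by move: hi hj; rewrite mem_box !mem_zrange; lia.
Qed.

Lemma sum_box (f g : int -> C) M :
  \sum_(x <- box M) f x.1 * g x.2 =
  (\sum_(k <- zrange M) f k) * (\sum_(l <- zrange M) g l).
Proof.
by rewrite big_allpairs mulr_suml; apply: eq_bigr => k _; rewrite mulr_sumr.
Qed.

End LatticeSums.

Section RankTwo.
Variable C : numFieldType.
Hypothesis complete : geo_complete C.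
Variable p : C.
Hypothesis p_lt1 : `|p| < 1.

Lemma cvg_odd_index : (fun M : nat => M.*2.+1) @ \oo --> \oo.
Proof. by move=> A [N _ hN]; exists N => // M /= le; apply: hN => /=; lia. Qed.

Lemma normr_exprz (z : C) (k : int) : `|z ^ k| = `|z| ^ k.
Proof. by case: k => n; rewrite ?NegzE -?exprnN -?exprnP ?normfV normrX. Qed.

Lemma rotate_powers (x y : C) (i j : int) : x != 0 -> y != 0 ->
  (- (x * y)) ^ (i + j) * (- (x / y)) ^ (i - j) = (x ^+ 2) ^ i * (y ^+ 2) ^ j.
Proof.
move=> x0 y0.
have xy0 : - (x * y) != 0 by rewrite oppr_eq0 mulf_neq0.
have xVy0 : - (x / y) != 0 by rewrite oppr_eq0 mulf_neq0 ?invr_neq0.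
rewrite !expfzDr // -[_ ^ (- j)]exprz_inv mulrACA -!expfzMl.
by congr (_ ^ _ * _ ^ _); field; rewrite ?x0 ?y0.
Qed.

(** The exponents k^2, k (k - 1) and k (k + 1) that appear once the double series is
    written in the rotated coordinates. *)
Definition sq_exp (k : int) : nat := (absz k ^ 2)%N.
Definition pronic_exp (k : int) : nat := (tri k).*2.
Definition pronic_exp' (k : int) : nat := (tri (- k)).*2.

(** The partial sums over diamonds factor, those over boxes converge to the product of
    the two series, and the diamonds lie between boxes. *)
Lemma cvg_product_series (x y : C) : p != 0 -> x != 0 -> y != 0 ->
  (fun M => gsum pronic_exp p (x ^+ 2) M * gsum sq_exp p (y ^+ 2) M
     - x * gsum sq_exp p (x ^+ 2) M * (y * gsum pronic_exp' p (y ^+ 2) M))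
  @ \oo --> limn (gsum tri p (- (x * y))) * limn (gsum tri p (- (x / y))).
Proof.
move=> p0 x0 y0.
have xy0 : - (x * y) != 0 by rewrite oppr_eq0 mulf_neq0.
have xVy0 : - (x / y) != 0 by rewrite oppr_eq0 mulf_neq0 ?invr_neq0.
pose f k := (- (x * y)) ^ k * p ^+ tri k; pose g k := (- (x / y)) ^ k * p ^+ tri k.
pose F (u : int * int) := f u.1 * g u.2.
pose N M := \sum_(u <- box M) `|F u|.
have hA : (fun M => \sum_(u <- box M) F u) @ \oo -->
    limn (gsum tri p (- (x * y))) * limn (gsum tri p (- (x / y))).
  apply: (@cvg_seq_ext _ (gsum tri p (- (x * y)) \* gsum tri p (- (x / y)))).
    by move=> M; rewrite /F (sum_box f g).
  apply: cvgM; [exact: (cvg_gsum complete p_lt1 xy0 tri_ge) | exact: (cvg_gsum complete p_lt1 xVy0 tri_ge)].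
have [L hN] : exists L : C, N @ \oo --> L.
  have pn : `| `|p| | < 1 by rewrite normr_id.
  exists (limn (gsum tri `|p| `|- (x * y)|) * limn (gsum tri `|p| `|- (x / y)|)).
  apply: (@cvg_seq_ext _ (gsum tri `|p| `|- (x * y)| \* gsum tri `|p| `|- (x / y)|)).
    move=> M /=; rewrite /N.
    rewrite (eq_bigr (fun u : int * int => `|f u.1| * `|g u.2|)) => [|u _]; last exact: normrM.
    rewrite (sum_box (fun k => `|f k|) (fun k => `|g k|)).
    by congr (_ * _); apply: eq_bigr => k _; rewrite normrM normrX normr_exprz.
  by apply: cvgM; refine (cvg_gsum complete pn _ tri_ge); rewrite normr_eq0.
have hD : (fun M => \sum_(u <- diamond M) F u) @ \oo -->
    limn (gsum tri p (- (x * y))) * limn (gsum tri p (- (x / y))).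
  have h0 : (fun M => N M.*2.+1 - N M) @ \oo --> (0 : C).
    by rewrite -(subrr L); apply: cvgB => //; apply: (cvg_comp _ _ cvg_odd_index hN).
  have h1 : (fun M => \sum_(u <- diamond M) F u - \sum_(u <- box M) F u) @ \oo --> (0 : C).
    apply/cvgrPdist_lt => e e0; have /cvgrPdist_lt /(_ e e0) := h0.
    apply: filterS => M; rewrite !sub0r !normrN; apply: le_lt_trans.
    have := sum_sandwich F (uniq_box M) (uniq_diamond M) (uniq_box M.*2.+1)
      (@box_sub_diamond M) (@diamond_sub_box M).
    rewrite -/(N M) -/(N M.*2.+1) => le; apply: le_trans (le) _.
    by apply: real_ler_norm; apply: ger0_real; apply: le_trans le.
  apply: (@cvg_seq_ext _ (fun M => \sum_(u <- diamond M) F u - \sum_(u <- box M) F u +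
    \sum_(u <- box M) F u)) => [M|]; first exact: subrK.
  by rewrite -[X in _ --> X]add0r; apply: cvgD.
apply: cvg_seq_ext hD => M /=.
rewrite big_cat /= !big_allpairs_dep /= /gsum; congr (_ + _).
  rewrite mulr_suml; apply: eq_bigr => i _; rewrite mulr_sumr; apply: eq_bigr => j _.
  rewrite /F /f /g /= mulrACA rotate_powers // -exprD.
  have -> : (tri (i + j) + tri (i - j) = pronic_exp i + sq_exp j)%N.
    have := tri_double (i + j); have := tri_double (i - j); have := tri_double i.
    by rewrite /pronic_exp /sq_exp; nia.
  by rewrite exprD mulrACA.
rewrite mulrACA mulr_suml mulr_sumr -sumrN; apply: eq_bigr => i _.
rewrite mulr_sumr mulr_sumr -sumrN; apply: eq_bigr => j _.
rewrite /F /f /g /= (_ : i + j + 1 = 1 + (i + j)); last by ring.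
have et : (tri (1 + (i + j)) + tri (i - j) = sq_exp i + pronic_exp' j)%N.
  have := tri_double (1 + (i + j)); have := tri_double (i - j); have := tri_double (- j).
  by rewrite /pronic_exp' /sq_exp; nia.
have ep : (- (x * y)) ^ (1 + (i + j)) * (- (x / y)) ^ (i - j) =
    - (x * y) * ((x ^+ 2) ^ i * (y ^+ 2) ^ j).
  by rewrite [in LHS]expfzDr // expr1z -mulrA rotate_powers.
rewrite [LHS]mulrACA ep -exprD et exprD; ring.
Qed.

(** The proof of the triple product divides by p; for p = 0 the factorization is read
    off theta(a) = 1 - a. *)
Lemma theta_factor_rank2 : exists E O e o : C -> C, forall x y, x != 0 -> y != 0 ->
  theta p (x * y) * theta p (x / y) = E x * e y - O x * o y.
Proof.
have [p0|p0] := eqVneq p 0.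
  have th0 a : theta p a = 1 - a.
    have p00 : `|0 : C| < 1 by rewrite normr0.
    rewrite (thetaE complete p_lt1) p0 mul0r (pochinfS complete p00 a) mulr0.
    have -> : pochinf (0 : C) 0 = 1.
      rewrite /pochinf; apply: cvg_lim; first exact: norm_hausdorff.
      apply: (@cvg_seq_ext _ (fun=> 1)); last exact: cvg_cst.
      by move=> n; rewrite big1 // => j _; rewrite mul0r subr0.
    by rewrite !mulr1.
  exists (fun x => 1 + x ^+ 2), id, (fun=> 1), (fun y => y + y^-1) => x y x0 y0.
  by rewrite !th0; field.
pose c := (pochinf p p)^-1.
exists (fun x => c ^+ 2 * limn (gsum pronic_exp p (x ^+ 2))),
  (fun x => c ^+ 2 * (x * limn (gsum sq_exp p (x ^+ 2)))),
  (fun y => limn (gsum sq_exp p (y ^+ 2))),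
  (fun y => y * limn (gsum pronic_exp' p (y ^+ 2))) => x y x0 y0.
have xy0 : x * y != 0 by rewrite mulf_neq0.
have xVy0 : x / y != 0 by rewrite mulf_neq0 ?invr_neq0.
rewrite !(theta_series complete p_lt1 p0) // -/c mulrACA.
have x20 : x ^+ 2 != 0 by rewrite expf_neq0.
have y20 : y ^+ 2 != 0 by rewrite expf_neq0.
have hsq k : ('C(absz k, 2) <= sq_exp k)%N by exact: le_bin2_sqr.
have hpr k : ('C(absz k, 2) <= pronic_exp k)%N.
  by apply: leq_trans (tri_ge k) _; rewrite /pronic_exp; lia.
have hpr' k : ('C(absz k, 2) <= pronic_exp' k)%N.
  by rewrite -abszN; apply: leq_trans (tri_ge _) _; rewrite /pronic_exp'; lia.
have h1 := cvg_gsum complete p_lt1 x20 hpr.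
have h2 := cvg_gsum complete p_lt1 y20 hsq.
have h3 := cvg_gsum complete p_lt1 x20 hsq.
have h4 := cvg_gsum complete p_lt1 y20 hpr'.
have h : (fun M => gsum pronic_exp p (x ^+ 2) M * gsum sq_exp p (y ^+ 2) M
     - x * gsum sq_exp p (x ^+ 2) M * (y * gsum pronic_exp' p (y ^+ 2) M)) @ \oo -->
  limn (gsum pronic_exp p (x ^+ 2)) * limn (gsum sq_exp p (y ^+ 2)) -
  x * limn (gsum sq_exp p (x ^+ 2)) * (y * limn (gsum pronic_exp' p (y ^+ 2))).
  apply: cvgB; first by apply: cvgM.
  by apply: cvgM; apply: cvgMr.
rewrite (cvg_num_unique (cvg_product_series p0 x0 y0) h); ring.
Qed.

End RankTwo.

(** * Interpolation by products of theta functions *)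

Section BinaryForms.
Variable F : fieldType.
Implicit Types (v w : F) (f : F -> F -> F) (m : nat).

(** Homogeneous forms of degree m in (v, w), encoded by their dehomogenization P
    in v / w; the last clause gives the values on the line w = 0. *)
Definition binary_form m f := exists2 P : {poly F}, (size P <= m.+1)%N &
  (forall v w, w != 0 -> f v w = w ^+ m * P.[v / w]) /\
  (forall v, f v 0 = P`_m * v ^+ m).

Lemma binary_form_const k : binary_form 0 (fun _ _ => k).
Proof.
exists k%:P; first by rewrite size_polyC; case: eqP.
by split=> [v w _ | v]; rewrite expr0 ?hornerC ?coefC ?mul1r ?mulr1.
Qed.

Lemma binary_formD m f g : binary_form m f -> binary_form m g ->
  binary_form m (fun v w => f v w + g v w).
Proof.
move=> [P sP [fP fP0]] [Q sQ [gQ gQ0]]; exists (P + Q).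
  by apply: leq_trans (size_polyD _ _) _; rewrite geq_max sP.
split=> [v w w0|v]; first by rewrite fP // gQ // hornerD mulrDr.
by rewrite fP0 gQ0 coefD mulrDl.
Qed.

Lemma binary_form_linear m f (k l : F) : binary_form m f ->
  binary_form m.+1 (fun v w => (k * v - l * w) * f v w).
Proof.
move=> [P sP [fP fP0]]; pose L : {poly F} := k *: 'X - l%:P; exists (L * P).
  apply: leq_trans (size_polyMleq _ _) _.
  have : (size L <= 2)%N.
    apply: leq_trans (size_polyD _ _) _; rewrite geq_max size_polyN.
    by rewrite (leq_trans (size_scale_leq _ _)) ?size_polyX // size_polyC; case: eqP.
  by move: sP; lia.
split=> [v w w0|v].
  rewrite fP // hornerM /L hornerD hornerN hornerC hornerZ hornerX exprS; by field.
have -> : (L * P)`_m.+1 = k * P`_m.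
  by rewrite /L mulrBl coefB -scalerAl coefZ coefXM coefCM /= [P`_m.+1]nth_default // mulr0 subr0.
by rewrite fP0 exprS; ring.
Qed.

Definition independent (x y : F * F) := x.1 * y.2 - x.2 * y.1 != 0.

(** Each point off the line w = 0 gives a root v / w of P, and a point on that line
    lowers the degree of P instead. *)
Lemma binary_form_eq0 m f (pts : seq (F * F)) : binary_form m f ->
  size pts = m.+1 -> pairwise independent pts -> (forall x, x \in pts -> f x.1 x.2 = 0) ->
  forall v w, f v w = 0.
Proof.
move=> [P sP [fP fP0]] spts ind f0.
suff P0 : P = 0.
  move=> v w; have [->|w0] := eqVneq w 0; first by rewrite fP0 P0 coef0 mul0r.
  by rewrite fP // P0 horner0 mulr0.
have main s : pairwise independent s -> all (fun x => x.2 != 0) s ->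
    {subset s <= pts} -> (size P <= size s)%N -> P = 0.
  move=> inds hs sub; apply: contraTeq => Pn0; rewrite -ltnNge.
  rewrite -(size_map (fun x => x.1 / x.2)); apply: max_poly_roots => //.
    apply/allP => _ /mapP [x xs ->]; rewrite /root.
    have x2 := allP hs _ xs; have := f0 _ (sub _ xs); rewrite fP //.
    by move/eqP; rewrite mulf_eq0 expf_eq0 (negPf x2) andbF.
  rewrite uniq_pairwise pairwise_map; move: inds; apply: sub_in_pairwise hs => x y /= x0 y0.
  rewrite /independent; apply: contraNneq => /eqP; rewrite eqr_div // => /eqP ->.
  by rewrite mulrC subrr.
have [/hasP [x xs /eqP x0]|] := boolP (has (fun x => x.2 == 0) pts); last first.
  by rewrite -all_predC => h; apply: (main pts) => //; rewrite spts.
have Pm : P`_m = 0.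
  have := f0 _ xs; rewrite x0 fP0 => /eqP; rewrite mulf_eq0 expf_eq0 => /orP[/eqP //|/andP[m0 /eqP x1]].
  move: spts ind xs m0; case: m {sP fP fP0} => // m.
  case: pts {f0 main} => // a [//|b s] _ /= /andP[/andP[hab /allP ha] /andP[/allP hb _]].
  rewrite !inE => /or3P[/eqP e|/eqP e|xs] _.
  - by move: hab; rewrite /independent -e x0 x1 !mul0r subrr eqxx.
  - by move: hab; rewrite /independent -e x0 x1 !mulr0 subrr eqxx.
  - by have := ha _ xs; rewrite /independent x0 x1 !mulr0 subrr eqxx.
have sP' : (size P <= m)%N.
  rewrite leqNgt; apply/negP => lt; have e : size P = m.+1 by apply/eqP; rewrite eqn_leq sP.
  have : lead_coef P = 0 by rewrite /lead_coef e.
  by move/eqP; rewrite lead_coef_eq0 -size_poly_eq0 e.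
have [s1 [s2 e]] : exists s1 s2, pts = s1 ++ x :: s2.
  by case/splitPr: xs => s1 s2; exists s1, s2.
apply: (main (s1 ++ s2)).
- move: ind; rewrite e !pairwise_cat /= allrel_consr.
  by move=> /and3P[/andP[_ ->] -> /andP[_ ->]].
- have nz y : independent x y \/ independent y x -> y.2 != 0.
    rewrite /independent x0 => -[]; apply: contraNneq => ->.
      by rewrite mul0r mulr0 subrr.
    by rewrite mul0r mulr0 subrr.
  move: ind; rewrite e pairwise_cat /= allrel_consr all_cat.
  move=> /and3P[/andP[/allP h1 _] _ /andP[/allP h2 _]].
  by apply/andP; split; apply/allP => y ys; apply: nz; [right; apply: h1 | left; apply: h2].
- by move=> y; rewrite e !mem_cat inE => /orP[->|->]; rewrite ?orbT.
- apply: leq_trans sP' _; rewrite size_cat -ltnS.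
  by rewrite -spts e size_cat /= addnS.
Qed.

End BinaryForms.

Section ThetaForms.
Variable C : numClosedFieldType.
Hypothesis complete : geo_complete C.
Variable p : C.
Hypothesis p_lt1 : `|p| < 1.
Notation th := (theta p).

(** With r^2 = kap and y = c / r the pair of factors is theta(r u y) theta(r u / y), to
    which the rank-two factorization applies. Two values of c with proportional vectors
    would annihilate theta(y y') theta(y / y'). *)
Lemma theta_pencil (kap : C) : kap != 0 -> exists v w : C -> C,
  (forall u, u != 0 -> exists k l, forall c, c != 0 ->
     th (c * u) * th (kap * u / c) = k * v c - l * w c) /\
  (forall c c', c != 0 -> c' != 0 -> th (c / c') != 0 -> th (c * c' / kap) != 0 ->
     v c * w c' - w c * v c' != 0).
Proof.
move=> k0; have [E [O [e [o h]]]] := theta_factor_rank2 complete p_lt1.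
pose r := sqrtC kap; have rr : r ^+ 2 = kap by rewrite sqrtCK.
have r0 : r != 0 by rewrite sqrtC_eq0.
exists (fun c => e (c / r)), (fun c => o (c / r)); split.
  move=> u u0; exists (E (r * u)), (O (r * u)) => c c0.
  rewrite -h ?mulf_neq0 ?invr_neq0 // -rr.
  by congr (th _ * th _); field; rewrite ?c0 ?r0.
move=> c c' c0 c0' hd hm.
set y := c / r; set y' := c' / r.
have y0 : y != 0 by rewrite mulf_neq0 ?invr_neq0.
have y0' : y' != 0 by rewrite mulf_neq0 ?invr_neq0.
have e1 : y / y' = c / c' by rewrite /y /y'; field; rewrite ?c0' ?r0.
have e2 : y * y' = c * c' / kap by rewrite /y /y' -rr; field; rewrite ?r0.
have n1 : E y * e y' - O y * o y' != 0 by rewrite -h // e1 e2 mulf_neq0.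
have n2 : E y' * e y - O y' * o y != 0.
  rewrite -h // mulf_neq0 //; first by rewrite mulrC e2.
  have q0 : y / y' != 0 by rewrite mulf_neq0 ?invr_neq0.
  rewrite -invf_div (thetaV complete p_lt1 q0); apply: mulf_neq0; last exact: invr_neq0.
  by rewrite oppr_eq0 e1.
have z : E y * e y - O y * o y = 0.
  by rewrite -h // divff // theta1 // mulr0.
apply: contra_neq n2 => d.
clearbody y y'.
have oy : o y = 0.
  apply: (mulIf n1); rewrite mul0r.
  rewrite (_ : o y * _ = (E y * e y - O y * o y) * o y' - E y * (e y * o y' - o y * e y')); last by ring.
  by rewrite z d mul0r mulr0 subrr.
have ey : e y = 0.
  apply: (mulIf n1); rewrite mul0r.
  rewrite (_ : e y * _ = (E y * e y - O y * o y) * e y' - O y * (e y * o y' - o y * e y')); last by ring.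
  by rewrite z d mul0r mulr0 subrr.
by rewrite oy ey !mulr0 subrr.
Qed.

(** Linear combinations of products of m factors theta(c u) theta(kap u / c); each
    product is recorded as a pair (coefficient, values of u). *)
Definition theta_form (kap : C) (m : nat) (f : C -> C) :=
  exists2 l : seq (C * seq C),
    all (fun x => (size x.2 == m) && all (fun u => u != 0) x.2) l &
    forall c, c != 0 ->
      f c = \sum_(x <- l) x.1 * \prod_(u <- x.2) (th (c * u) * th (kap * u / c)).

Lemma theta_form_monomial (kap k : C) (us : seq C) (f : C -> C) m :
  size us = m -> all (fun u => u != 0) us ->
  (forall c, c != 0 -> f c = k * \prod_(u <- us) (th (c * u) * th (kap * u / c))) ->
  theta_form kap m f.
Proof.
move=> sz us0 hf; exists [:: (k, us)]; first by rewrite /= sz eqxx us0.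
by move=> c c0; rewrite big_seq1 hf.
Qed.

Lemma theta_formD (kap : C) m f g : theta_form kap m f -> theta_form kap m g ->
  theta_form kap m (fun c => f c + g c).
Proof.
move=> [l hl hf] [l' hl' hg]; exists (l ++ l'); first by rewrite all_cat hl.
by move=> c c0; rewrite big_cat hf // hg.
Qed.

Lemma theta_formN (kap : C) m f : theta_form kap m f ->
  theta_form kap m (fun c => - f c).
Proof.
move=> [l hl hf]; exists [seq (- x.1, x.2) | x <- l]; first by rewrite all_map.
by move=> c c0; rewrite big_map hf // -sumrN; apply: eq_bigr => x _; rewrite /= mulNr.
Qed.

Lemma theta_form_sum (kap : C) m (J : Type) (s : seq J) (P : pred J) (f : J -> C -> C) :
  (forall j, P j -> theta_form kap m (f j)) ->
  theta_form kap m (fun c => \sum_(j <- s | P j) f j c).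
Proof.
move=> hf; elim: s => [|j s IH].
  by exists [::] => // c _; rewrite !big_nil.
case Pj: (P j); last first.
  by case: IH => l hl h; exists l => // c c0; rewrite big_cons Pj h.
have [l hl h] := theta_formD (hf j Pj) IH.
by exists l => // c c0; rewrite big_cons Pj -h.
Qed.

(** The factors theta(c u) theta(kap u / c) are linear forms in a vector (v c, w c)
    that does not depend on u, so f is a binary form of degree m in that vector. *)
Lemma theta_form_interpolation (kap : C) m f (cs : seq C) : kap != 0 ->
  theta_form kap m f -> size cs = m.+1 -> all (fun c => c != 0) cs ->
  pairwise (fun c c' => (th (c / c') != 0) && (th (c * c' / kap) != 0)) cs ->
  (forall c, c \in cs -> f c = 0) -> forall c, c != 0 -> f c = 0.
Proof.
move=> k0 [l hl hf] sz cs0 pw f0.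
have [v [w [hlin hind]]] := theta_pencil k0.
have [g hg fg] : exists2 g, binary_form m g & forall c, c != 0 -> f c = g (v c) (w c).
  suff [g hg fg] : exists2 g, binary_form m g & forall c, c != 0 ->
      \sum_(x <- l) x.1 * \prod_(u <- x.2) (th (c * u) * th (kap * u / c)) = g (v c) (w c).
    by exists g => // c c0; rewrite hf // fg.
  elim: l hl {hf f0} => [_|[k us] l IH /= /andP[/andP[/eqP szu us0] /IH [g hg fg]]].
    exists (fun _ _ => 0) => [|c c0]; last by rewrite big_nil.
    exists 0; first by rewrite size_poly0.
    by split=> [v' w' _|v']; rewrite ?horner0 ?mulr0 ?coef0 ?mul0r.
  have [g' hg' fg'] : exists2 g', binary_form m g' & forall c, c != 0 ->
      k * \prod_(u <- us) (th (c * u) * th (kap * u / c)) = g' (v c) (w c).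
    rewrite -szu; elim: us us0 {szu} => [_|u us IHu /= /andP[u0 /IHu [g' hg' fg']]].
      exists (fun _ _ => k) => [|c c0]; last by rewrite big_nil mulr1.
      exact: binary_form_const.
    have [k1 [k2 hk]] := hlin u u0.
    exists (fun v w => (k1 * v - k2 * w) * g' v w); first exact: binary_form_linear.
    by move=> c c0; rewrite big_cons mulrCA fg' // hk.
  exists (fun v w => g' v w + g v w); first exact: binary_formD.
  by move=> c c0; rewrite big_cons fg' // fg.
have g0 : forall v w, g v w = 0.
  apply: (binary_form_eq0 (pts := [seq (v c, w c) | c <- cs]) hg).
  - by rewrite size_map.
  - rewrite pairwise_map; move: pw; apply: sub_in_pairwise cs0 => c c' /= c0 c0' /andP[h1 h2].
    exact: hind.
  - by move=> _ /mapP [c hc ->] /=; rewrite -fg ?f0 // (allP cs0).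
by move=> c c0; rewrite fg.
Qed.

End ThetaForms.

(* From here on, set operations are those of finite sets. *)
Import mathcomp.boot.fintype mathcomp.boot.finset.

(** * The Jackson summation over subsets *)

Section SubsetJackson.
Variable C : numClosedFieldType.
Hypothesis complete : geo_complete C.
Variables (p q : C).
Hypothesis p_lt1 : `|p| < 1.
Hypothesis q_neq0 : q != 0.
Notation th := (theta p).
Definition tpoch (x : C) (k : nat) : C := \prod_(0 <= j < k) th (x * q ^+ j).
Arguments tpoch : simpl never.
Notation sf := tpoch.

Lemma tpoch0 (x : C) : sf x 0 = 1.
Proof. by rewrite /tpoch big_geq. Qed.

Lemma tpochSr (x : C) k : sf x k.+1 = sf x k * th (x * q ^+ k).
Proof. by rewrite /tpoch big_nat_recr. Qed.

Lemma tpochD (x : C) k l : sf x (k + l) = sf x k * sf (x * q ^+ k) l.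
Proof.
elim: l => [|l IH]; first by rewrite addn0 tpoch0 mulr1.
by rewrite addnS !tpochSr IH exprD !mulrA.
Qed.

Lemma tpochSl (x : C) k : sf x k.+1 = th x * sf (x * q) k.
Proof. by rewrite -add1n tpochD tpochSr tpoch0 mul1r expr0 mulr1 expr1. Qed.

Lemma tpoch1 k : sf 1 k.+1 = 0.
Proof. by rewrite tpochSl theta1 // mul0r. Qed.

Variables (I : finType) (z : I -> C).
Implicit Types (A S : {set I}) (r s : I) (a c d lam : C).

(** The variable part of the kernel of the sum; it plays the role of the Vandermonde
    and shifted factorials in x_r / x_s when each N_r is 1. *)
Definition cross A S : C :=
  \prod_(r in A :\: S) \prod_(s in S) (th (q * z r / z s) / th (z r / z s)).

Definition jackson_term a c d lam A S : C :=
  cross A S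
  * (sf lam (#|A| - #|S|)
     * (sf c #|S| * sf (a * q / (lam * c * d)) #|S| / sf (a * q / d) #|S|) * lam ^+ #|S|)
  * (\prod_(s in S) (th (lam * a * z s * q ^+ #|A|) * th (d * z s) / th (a * z s * q ^+ #|S|)))
  * (\prod_(r in A :\: S)
       (th (a * z r * q / c) * th (lam * c * d * z r) / th (a * z r * q ^+ #|S|.+1))).

Definition jackson_value a c d lam A : C :=
  sf (lam * c) #|A| * sf (a * q / (c * d)) #|A| / sf (a * q / d) #|A|
  * \prod_(r in A) th (lam * d * z r).

Definition jackson_admissible a d A :=
  [/\ forall r, z r != 0,
      {in A &, forall r s, r != s -> th (z r / z s) != 0},
      (forall r k, r \in A -> th (a * z r * q ^+ k.+1) != 0)
    & (forall k, th (a * q / d * q ^+ k) != 0)].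

Lemma jackson_admissible_tpoch_neq0 a d A k : jackson_admissible a d A -> sf (a * q / d) k != 0.
Proof.
case=> _ _ _ h; rewrite /tpoch prodf_seq_neq0; apply/allP => j _.
by rewrite h implybT.
Qed.

Lemma theta_form_jackson_term a d lam A S : a != 0 -> d != 0 -> lam != 0 ->
  (forall r, z r != 0) -> S \subset A ->
  theta_form p (a * q / (lam * d)) #|A| (fun c => jackson_term a c d lam A S).
Proof.
move=> a0 d0 l0 z0 sub.
pose us := [seq q ^+ i | i <- iota 0 #|S|] ++ [seq lam * d * z r | r <- enum (A :\: S)].
apply: (@theta_form_monomial _ _ _ (cross A S * (sf lam (#|A| - #|S|) / sf (a * q / d) #|S| * lam ^+ #|S|)
  * (\prod_(s in S) (th (lam * a * z s * q ^+ #|A|) * th (d * z s) / th (a * z s * q ^+ #|S|)))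
  / (\prod_(r in A :\: S) th (a * z r * q ^+ #|S|.+1))) us).
- rewrite size_cat !size_map size_iota -cardE -(cardsID S A) (setIidPr sub).
  by [].
- rewrite all_cat !all_map; apply/andP; split; apply/allP => x _ /=.
    by rewrite expf_neq0.
  by rewrite !mulf_neq0.
move=> c c0; rewrite /jackson_term big_cat !big_map /= big_enum /=.
rewrite ![\prod_(r in A :\: S) (_ * _)]big_split /= prodfV ![\prod_(i <- iota _ _) _]big_split /=.
have -> : \prod_(i <- iota 0 #|S|) th (c * q ^+ i) = sf c #|S|.
  by rewrite /tpoch /index_iota subn0.
have -> : \prod_(i <- iota 0 #|S|) th (a * q / (lam * d) * q ^+ i / c) =
    sf (a * q / (lam * c * d)) #|S|.
  rewrite /tpoch /index_iota subn0; apply: eq_bigr => i _; congr th.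
  by field; rewrite ?c0 ?d0 ?l0.
have -> : \prod_(r in A :\: S) th (c * (lam * d * z r)) =
    \prod_(r in A :\: S) th (lam * c * d * z r).
  by apply: eq_bigr => r _; congr th; ring.
have -> : \prod_(r in A :\: S) th (a * q / (lam * d) * (lam * d * z r) / c) =
    \prod_(r in A :\: S) th (a * z r * q / c).
  by apply: eq_bigr => r _; congr th; field; rewrite ?c0 ?d0 ?l0.
ring.
Qed.

Lemma theta_form_jackson_value a d lam A : a != 0 -> d != 0 -> lam != 0 ->
  theta_form p (a * q / (lam * d)) #|A| (fun c => jackson_value a c d lam A).
Proof.
move=> a0 d0 l0.
apply: (@theta_form_monomial _ _ _ ((\prod_(r in A) th (lam * d * z r)) / sf (a * q / d) #|A|)
  [seq lam * q ^+ i | i <- iota 0 #|A|]).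
- by rewrite size_map size_iota.
- by rewrite all_map; apply/allP => x _ /=; rewrite mulf_neq0 ?expf_neq0.
move=> c c0; rewrite /jackson_value big_map big_split /=.
have -> : \prod_(i <- iota 0 #|A|) th (c * (lam * q ^+ i)) = sf (lam * c) #|A|.
  by rewrite /tpoch /index_iota subn0; apply: eq_bigr => i _; congr th; ring.
have -> : \prod_(i <- iota 0 #|A|) th (a * q / (lam * d) * (lam * q ^+ i) / c) =
    sf (a * q / (c * d)) #|A|.
  rewrite /tpoch /index_iota subn0; apply: eq_bigr => i _; congr th.
  by field; rewrite ?c0 ?d0 ?l0.
ring.
Qed.

(** At c = a z_r q the factor theta(a z_x q / c) of each x outside S cancels the
    denominator theta(z_x / z_r) of the cross factor, and what remains is the same
    factor with a q in place of a. *)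
Lemma jackson_term_reduce a d lam A S r : a != 0 -> d != 0 -> lam != 0 ->
  jackson_admissible a d A -> r \in A -> S \subset A :\ r ->
  jackson_term a (a * z r * q) d lam A (r |: S) =
  th (a * q / (lam * (a * z r * q) * d)) / th (a * q / d) * lam
    * th (lam * a * z r * q ^+ #|A|) * th (d * z r)
  * jackson_term (a * q) (a * z r * q) d lam (A :\ r) S.
Proof.
move=> a0 d0 l0 gen rA sub; have [z0 hz ha hd] := gen.
have rS : r \notin S by apply/negP => /(subsetP sub); rewrite !inE eqxx.
have cS : #|r |: S| = #|S|.+1 by rewrite cardsU1 rS.
have cA : #|A| = #|A :\ r|.+1 by rewrite (cardsD1 r) rA.
set c := a * z r * q.
have c0 : c != 0 by rewrite !mulf_neq0.
rewrite /jackson_term; have -> : A :\: (r |: S) = (A :\ r) :\: S by rewrite setDDl.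
set D := (A :\ r) :\: S.
have -> : cross A (r |: S) = cross (A :\ r) S *
    \prod_(x in D) (th (q * z x / z r) / th (z x / z r)).
  rewrite /cross (_ : A :\: (r |: S) = D); last by rewrite /D setDDl.
  rewrite -big_split; apply: eq_bigr => x _ /=.
  by rewrite big_setU1 //= mulrC.
rewrite cS cA subSS [sf c _.+1]tpochSr [sf (a * q / (lam * c * d)) _.+1]tpochSl.
rewrite [sf (a * q / d) _.+1]tpochSl exprS big_setU1 //=.
have -> : c * q ^+ #|S| = a * z r * q ^+ #|S|.+1 by rewrite /c exprS; ring.
have -> : a * q / (lam * c * d) * q = a * q * q / (lam * c * d) by ring.
have -> : a * q / d * q = a * q * q / d by ring.
have -> : \prod_(s in S) (th (lam * a * z s * q ^+ #|A :\ r|.+1) * th (d * z s) /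
      th (a * z s * q ^+ #|S|.+1)) =
    \prod_(s in S) (th (lam * (a * q) * z s * q ^+ #|A :\ r|) * th (d * z s) /
      th (a * q * z s * q ^+ #|S|)).
  apply: eq_bigr => s _; rewrite !exprS.
  by congr (th _ * _ / th _); ring.
have hr : th (a * z r * q ^+ #|S|.+1) != 0 by apply: ha.
have hq : th (a * q / d) != 0 by have := hd 0%N; rewrite expr0 mulr1.
have e : \prod_(x in D) (th (q * z x / z r) / th (z x / z r)) *
    \prod_(x in D) (th (a * z x * q / c) * th (lam * c * d * z x) / th (a * z x * q ^+ #|S|.+2)) =
    \prod_(x in D) (th (a * q * z x * q / c) * th (lam * c * d * z x) /
      th (a * q * z x * q ^+ #|S|.+1)).
  rewrite -big_split; apply: eq_bigr => x xD /=.
  have -> : a * q * z x * q / c = q * z x / z r by rewrite /c; field; rewrite ?a0 ?q_neq0 ?z0.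
  have -> : a * z x * q / c = z x / z r by rewrite /c; field; rewrite ?a0 ?q_neq0 ?z0.
  have -> : a * q * z x * q ^+ #|S|.+1 = a * z x * q ^+ #|S|.+2 by rewrite !exprS; ring.
  have n1 : th (z x / z r) != 0.
    by apply: hz => //; move: xD; rewrite !inE => /and3P[].
  have n2 : th (a * z x * q ^+ #|S|.+2) != 0.
    by apply: ha; move: xD; rewrite !inE => /and3P[].
  by field; rewrite ?n1 ?n2.
rewrite -e.
have hs : sf (a * q * q / d) #|S| != 0.
  apply/contra_neq/(jackson_admissible_tpoch_neq0 #|S|.+1 gen) => h0.
  by rewrite tpochSl (_ : a * q / d * q = a * q * q / d) ?h0 ?mulr0 //; ring.
by field; rewrite ?hr ?hq ?hs.
Qed.

Lemma jackson_value_reduce a d lam A r : a != 0 -> d != 0 -> lam != 0 ->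
  jackson_admissible a d A -> r \in A ->
  jackson_value a (a * z r * q) d lam A =
  th (a * q / (lam * (a * z r * q) * d)) / th (a * q / d) * lam
    * th (lam * a * z r * q ^+ #|A|) * th (d * z r)
  * jackson_value (a * q) (a * z r * q) d lam (A :\ r).
Proof.
move=> a0 d0 l0 gen rA; have [z0 hz ha hd] := gen.
have cA : #|A| = #|A :\ r|.+1 by rewrite (cardsD1 r) rA.
set c := a * z r * q.
have zr := z0 r.
rewrite /jackson_value (big_setD1 r) //= cA tpochSr [sf (a * q / (c * d)) _.+1]tpochSl [sf (a * q / d) _.+1]tpochSl.
have -> : lam * c * q ^+ #|A :\ r| = lam * a * z r * q ^+ #|A :\ r|.+1 by rewrite /c exprS; ring.
have -> : a * q / (c * d) * q = a * q * q / (c * d) by ring.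
have -> : a * q / d * q = a * q * q / d by ring.
have -> : a * q / (c * d) = (d * z r)^-1 by rewrite /c; field; rewrite ?a0 ?d0 ?q_neq0 ?zr.
have -> : a * q / (lam * c * d) = (lam * d * z r)^-1.
  by rewrite /c; field; rewrite ?a0 ?d0 ?q_neq0 ?zr ?l0.
rewrite !(thetaV complete p_lt1) ?mulf_neq0 //.
have hq : th (a * q / d) != 0 by have := hd 0%N; rewrite expr0 mulr1.
have hs : sf (a * q * q / d) #|A :\ r| != 0.
  apply/contra_neq/(jackson_admissible_tpoch_neq0 #|A :\ r|.+1 gen) => h0.
  by rewrite tpochSl (_ : a * q / d * q = a * q * q / d) ?h0 ?mulr0 //; ring.
by field; rewrite ?hs ?hq ?d0 ?zr ?l0.
Qed.

(** Induction on the size of A; the interpolation points are 1 and the a z_r q. *)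
Lemma jackson_nondegenerate a c d lam A : a != 0 -> c != 0 -> d != 0 -> lam != 0 ->
  jackson_admissible a d A ->
  {in A, forall r, th (lam * d * z r) != 0} ->
  {in A &, forall r s, r != s -> forall k, (k < #|A|)%N ->
    th (a * lam * d * z r * z s * q ^+ k.+1) != 0} ->
  \sum_(S : {set I} | S \subset A) jackson_term a c d lam A S = jackson_value a c d lam A.
Proof.
have [m] := ubnP #|A|; elim: m => // m IH in A a c *; rewrite ltnS => leA.
move=> a0 c0 d0 l0 gen g1 g2; have [z0 hz ha hd] := gen.
apply/eqP; rewrite -subr_eq0; apply/eqP; move: c c0.
have kap0 : a * q / (lam * d) != 0 by rewrite !mulf_neq0 ?invr_neq0 ?mulf_neq0.
pose f c := \sum_(S : {set I} | S \subset A) jackson_term a c d lam A S - jackson_value a c d lam A.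
apply: (@theta_form_interpolation _ complete p p_lt1 (a * q / (lam * d)) #|A| f
  (1 :: [seq a * z r * q | r <- enum A])) => //.
- apply: theta_formD; last by apply: theta_formN; apply: theta_form_jackson_value.
  by apply: theta_form_sum => S sub; apply: theta_form_jackson_term.
- by rewrite /= size_map -cardE.
- rewrite /= oner_eq0 all_map; apply/allP => r _ /=; by rewrite !mulf_neq0.
- rewrite /= all_map pairwise_map; apply/andP; split.
    apply/allP => r; rewrite mem_enum => rA /=; apply/andP; split.
      have h0 : a * z r * q != 0 by rewrite !mulf_neq0.
      rewrite div1r (thetaV complete p_lt1 h0) mulf_neq0 ?invr_neq0 // oppr_eq0.
      by have := ha r 0%N rA; rewrite expr1.
    rewrite mul1r (_ : _ / _ = lam * d * z r) ?g1 //.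
    by field; rewrite ?a0 ?d0 ?l0 ?q_neq0.
  have : pairwise (fun r s => r != s) (enum A) by rewrite -uniq_pairwise enum_uniq.
  have hA : all (fun r => r \in A) (enum A) by apply/allP => r; rewrite mem_enum.
  apply: sub_in_pairwise hA => r s /= rA sA rs.
  rewrite (_ : _ / _ = z r / z s); last by field; rewrite ?a0 ?q_neq0 ?z0.
  rewrite hz //= (_ : _ / _ = a * lam * d * z r * z s * q ^+ 1) ?g2 //; first by rewrite (cardD1 r) rA.
  by rewrite expr1; field; rewrite ?a0 ?d0 ?l0 ?q_neq0.
move=> c; rewrite inE => /orP[/eqP ->|/mapP [r]].
  (* (1; q, p)_k vanishes for k > 0, so only the empty set survives *)
  rewrite /f (bigD1 set0) ?sub0set //= big1 => [|S /andP[_ S0]]; last first.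
    by rewrite /jackson_term -[#|S|]prednK ?card_gt0 // tpoch1 !(mul0r, mulr0).
  rewrite addr0 /jackson_term /jackson_value /cross cards0 subn0 !tpoch0 big_set0 setD0 big1; last first.
    by move=> r _; rewrite big_set0.
  rewrite !mulr1 mul1r divr1 (_ : a * q / (1 * d) = a * q / d) ?mul1r // mulfK; last first.
    exact: (jackson_admissible_tpoch_neq0 _ gen).
  apply/eqP; rewrite subr_eq0; apply/eqP; congr (_ * _); apply: eq_bigr => r rA.
  by rewrite ?mulr1 ?divr1 ?expr1 mulrAC mulfV ?mul1r //; have := ha r 0%N rA; rewrite expr1.
rewrite mem_enum => rA ->; have zr := z0 r.
set c' := a * z r * q.
have c0' : c' != 0 by rewrite !mulf_neq0.
(* a set avoiding r contributes the factor theta(a z_r q / c) = theta(1) = 0 *)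
rewrite /f (bigID (fun S : {set I} => r \in S)) /= [X in _ + X - _]big1 ?addr0; last first.
  move=> S /andP[sub rS]; rewrite /jackson_term [\prod_(x in A :\: S) _](big_setD1 r) ?inE ?rS //=.
  by rewrite /c' divff // theta1 // !mul0r mulr0.
rewrite (reindex_onto (fun S => r |: S) (fun S => S :\ r)) /=; last first.
  by move=> S /andP[_ rS]; rewrite setD1K.
rewrite (eq_bigl (fun S : {set I} => S \subset A :\ r)); last first.
  move=> S; rewrite setU11 andbT subUset sub1set rA /= subsetD1.
  congr (_ && _); apply/eqP/idP => [<-|rS]; first by rewrite !inE eqxx.
  by rewrite setU1K.
rewrite (eq_bigr (fun S => th (a * q / (lam * c' * d)) / th (a * q / d) * lam
    * th (lam * a * z r * q ^+ #|A|) * th (d * z r) * jackson_term (a * q) c' d lam (A :\ r) S)); last first.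
  by move=> S sub; rewrite jackson_term_reduce.
rewrite -mulr_sumr IH ?mulf_neq0 //.
- by rewrite -jackson_value_reduce // subrr.
- by move: leA; rewrite (cardsD1 r A) rA.
- split=> //.
  + by move=> s s'; rewrite !inE => /andP[_ sA] /andP[_ sA'] ss; apply: hz.
  + move=> s k; rewrite !inE => /andP[_ sA]; have := ha s k.+1 sA.
    by rewrite exprS (_ : a * z s * _ = a * q * z s * q ^+ k.+1) //; ring.
  + by move=> k; have := hd k.+1; rewrite exprS (_ : a * q / d * _ = a * q * q / d * q ^+ k) //; ring.
- by move=> s; rewrite !inE => /andP[_ sA]; apply: g1.
- move=> s s'; rewrite !inE => /andP[_ sA] /andP[_ sA'] ss k ltk; have := g2 s s' sA sA' ss k.+1.
  rewrite (cardsD1 r A) rA ltnS => /(_ ltk).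
  by rewrite exprS (_ : a * lam * _ * _ * _ * _ = a * q * lam * d * z s * z s' * q ^+ k.+1) //; ring.
Qed.

End SubsetJackson.

(** * Removal of the distinctness assumptions *)

Section Perturbation.
Variable C : numClosedFieldType.
Hypothesis complete : geo_complete C.

(** Points of the unit circle other than 1, tending to 1: the images of 2^-k under
    the Cayley transform. *)
Definition circle_seq (k : nat) : C := (1 + 'i * 2^-1 ^+ k) / (1 - 'i * 2^-1 ^+ k).

Lemma conj_cayley_den k : (1 + 'i * 2^-1 ^+ k : C)^* = 1 - 'i * 2^-1 ^+ k.
Proof.
rewrite rmorphD rmorph1 rmorphM /= conjCi mulNr; congr (1 - 'i * _).
by rewrite rmorphXn fmorphV rmorph_nat.
Qed.

Lemma cayley_num_neq0 k : 1 + 'i * 2^-1 ^+ k != 0 :> C.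
Proof.
apply/eqP => h; have h' := congr1 Num.conj h.
move: h'; rewrite conj_cayley_den rmorph0 => h'.
have : 1 + 'i * 2^-1 ^+ k + (1 - 'i * 2^-1 ^+ k) = 0 :> C by rewrite h h' addr0.
by rewrite addrACA subrr addr0 => /eqP; rewrite -(natrD _ 1 1) pnatr_eq0.
Qed.

Lemma cayley_den_neq0 k : 1 - 'i * 2^-1 ^+ k != 0 :> C.
Proof. by rewrite -conj_cayley_den conjC_eq0 cayley_num_neq0. Qed.

Lemma norm_circle_seq k : `|circle_seq k| = 1.
Proof.
rewrite normrM normfV -conj_cayley_den norm_conjC mulfV //.
by rewrite normr_eq0 cayley_num_neq0.
Qed.

Lemma circle_seq_neq1 k : circle_seq k != 1.
Proof.
apply/eqP => /(congr1 (fun x => x * (1 - 'i * 2^-1 ^+ k))).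
rewrite /circle_seq divfK ?cayley_den_neq0 // mul1r => /addrI /eqP.
rewrite -subr_eq0 opprK -mulr2n mulrn_eq0 mulf_eq0 expf_eq0 invr_eq0.
by rewrite pnatr_eq0 /= !(negPf (neq0Ci _)) andbF.
Qed.

Lemma cvg_circle_seq : circle_seq @ \oo --> (1 : C).
Proof.
have h2 : (fun k => 'i * 2^-1 ^+ k) @ \oo --> (0 : C).
  rewrite -(mulr0 'i); apply: cvgMr; apply: cvg_geo => //.
    by rewrite invr_ge0.
  by rewrite invf_lt1 ?ltr1n ?ltr0n.
rewrite -[X in _ --> X](divr1 1); apply: cvgM.
  by rewrite -[X in _ --> X]addr0; apply: cvgD => //; exact: cvg_cst.
apply: cvgV; first exact: oner_neq0.
by rewrite -[X in _ --> X]subr0; apply: cvgB => //; exact: cvg_cst.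
Qed.

Lemma cvg_prod_seq (J : Type) (s : seq J) (P : pred J) (f : J -> nat -> C) (l : J -> C) :
  (forall j, P j -> f j @ \oo --> l j) ->
  (fun k => \prod_(j <- s | P j) f j k) @ \oo --> \prod_(j <- s | P j) l j.
Proof.
move=> hf; elim: s => [|j s IH].
  rewrite big_nil; apply: (@cvg_seq_ext _ (fun=> 1)); last exact: cvg_cst.
  by move=> k; rewrite big_nil.
rewrite big_cons; case Pj: (P j).
  apply: (@cvg_seq_ext _ (fun k => f j k * \prod_(j <- s | P j) f j k)).
    by move=> k; rewrite big_cons Pj.
  by apply: cvgM => //; exact: hf.
by apply: cvg_seq_ext IH => k; rewrite big_cons Pj.
Qed.

Lemma cvg_sum_seq (J : Type) (s : seq J) (P : pred J) (f : J -> nat -> C) (l : J -> C) :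
  (forall j, P j -> f j @ \oo --> l j) ->
  (fun k => \sum_(j <- s | P j) f j k) @ \oo --> \sum_(j <- s | P j) l j.
Proof.
move=> hf; elim: s => [|j s IH].
  rewrite big_nil; apply: (@cvg_seq_ext _ (fun=> 0)); last exact: cvg_cst.
  by move=> k; rewrite big_nil.
rewrite big_cons; case Pj: (P j).
  apply: (@cvg_seq_ext _ (fun k => f j k + \sum_(j <- s | P j) f j k)).
    by move=> k; rewrite big_cons Pj.
  by apply: cvgD => //; exact: hf.
by apply: cvg_seq_ext IH => k; rewrite big_cons Pj.
Qed.

Lemma cvg_exprn (x : nat -> C) (y : C) m : x @ \oo --> y ->
  (fun k => x k ^+ m) @ \oo --> y ^+ m.
Proof.
move=> xy; elim: m => [|m IH]; first by apply: (@cvg_seq_ext _ (fun=> 1)) => //; exact: cvg_cst.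
by rewrite exprS; apply: (@cvg_seq_ext _ (fun k => x k * x k ^+ m)) => [k|]; rewrite ?exprS //; apply: cvgM.
Qed.

Variables (p q : C).
Hypothesis p_lt1 : `|p| < 1.
Hypothesis q_neq0 : q != 0.
Notation th := (theta p).

(** If K is a zero of theta then no other point of its circle is, and otherwise
    continuity suffices. *)
Lemma theta_circle_eventually (K : C) : K != 0 ->
  \forall k \near \oo, th (K * circle_seq k) != 0.
Proof.
move=> K0; have [z|nz] := eqVneq (th K) 0.
  exists 0%N => // k _ /=; apply/negP => /eqP zk.
  have := circle_seq_neq1 k; rewrite (theta_circle_zero complete p_lt1 K0 _ z zk) ?eqxx //.
  exact: norm_circle_seq.
have hc : (fun k => K * circle_seq k) @ \oo --> K.
  by rewrite -[X in _ --> X]mulr1; apply: cvgMr; exact: cvg_circle_seq.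
have /cvgrPdist_lt h := cvg_theta complete p_lt1 K0 hc.
have e0 : 0 < `|th K| by rewrite normr_gt0.
have := h _ e0; apply: filterS => k; apply: contraTneq => ->.
by rewrite subr0 ltxx.
Qed.

Lemma cvg_tpoch (x : nat -> C) (y : C) m : y != 0 -> x @ \oo --> y ->
  (fun k => tpoch p q (x k) m) @ \oo --> tpoch p q y m.
Proof.
move=> y0 xy; apply: cvg_prod_seq => j _.
apply: (cvg_theta complete p_lt1); first by rewrite mulf_neq0 ?expf_neq0.
by apply: cvgMl.
Qed.

Variables (I : finType) (z : I -> C).

(** Both sides are continuous in lam, and the distinctness conditions hold when lam is
    multiplied by circle_seq k with k large. *)
Lemma jackson_subset (a c d lam : C) (A : {set I}) :
  a != 0 -> c != 0 -> d != 0 -> lam != 0 -> jackson_admissible p q z a d A ->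
  \sum_(S : {set I} | S \subset A) jackson_term p q z a c d lam A S = jackson_value p q z a c d lam A.
Proof.
move=> a0 c0 d0 l0 gen; have [z0 hz ha hd] := gen.
pose L k := lam * circle_seq k.
have L0 k : L k != 0.
  by rewrite mulf_neq0 // -normr_gt0 norm_circle_seq.
have cL : L @ \oo --> lam.
  by rewrite -[X in _ --> X]mulr1; apply: cvgMr; exact: cvg_circle_seq.
have g1 : \forall k \near \oo, {in A, forall r, th (L k * d * z r) != 0}.
  suff : \forall k \near \oo, forall r, th (L k * d * z r) != 0 by apply: filterS => k h r _.
  apply: filter_forall => r; have K0 : lam * d * z r != 0 by rewrite !mulf_neq0.
  apply: filterS (theta_circle_eventually K0) => k.
  by rewrite (_ : lam * d * z r * _ = L k * d * z r) // /L; ring.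
have g2 : \forall k \near \oo, {in A &, forall r s, r != s -> forall j, (j < #|A|)%N ->
    th (a * L k * d * z r * z s * q ^+ j.+1) != 0}.
  suff : \forall k \near \oo, forall x : I * I * 'I_#|A|,
      th (a * L k * d * z x.1.1 * z x.1.2 * q ^+ x.2.+1) != 0.
    by apply: filterS => k h r s _ _ _ j ltj; exact: (h (r, s, Ordinal ltj)).
  apply: filter_forall => x.
  have K0 : a * lam * d * z x.1.1 * z x.1.2 * q ^+ x.2.+1 != 0 by rewrite !mulf_neq0 ?expf_neq0.
  apply: filterS (theta_circle_eventually K0) => k.
  by rewrite (_ : _ * circle_seq k = a * L k * d * z x.1.1 * z x.1.2 * q ^+ x.2.+1) // /L; ring.
have cl : (fun k => \sum_(S : {set I} | S \subset A) jackson_term p q z a c d (L k) A S) @ \oo -->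
    \sum_(S : {set I} | S \subset A) jackson_term p q z a c d lam A S.
  apply: cvg_sum_seq => S sub; rewrite /jackson_term.
  apply: cvgM; last first.
    apply: cvg_prod_seq => r _; apply: cvgMl; apply: cvgMr; apply: (cvg_theta complete p_lt1).
      by rewrite !mulf_neq0.
    by do 3! apply: cvgMl.
  apply: cvgM; last first.
    apply: cvg_prod_seq => r _; do 2!apply: cvgMl; apply: (cvg_theta complete p_lt1).
      by rewrite !mulf_neq0 ?expf_neq0.
    by do 3! apply: cvgMl.
  apply: cvgMr; apply: cvgM; last first.
    exact: cvg_exprn.
  apply: cvgM; first exact: cvg_tpoch.
  apply: cvgMl; apply: cvgMr; apply: cvg_tpoch; first by rewrite !mulf_neq0 ?invr_neq0 ?mulf_neq0.
  apply: cvgMr; apply: cvgV; first by rewrite !mulf_neq0.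
  by do 2! apply: cvgMl.
have cr : (fun k => jackson_value p q z a c d (L k) A) @ \oo --> jackson_value p q z a c d lam A.
  apply: cvgM; last first.
    apply: cvg_prod_seq => r _; apply: (cvg_theta complete p_lt1); first by rewrite !mulf_neq0.
    by do 2! apply: cvgMl.
  do 2! apply: cvgMl; apply: cvg_tpoch; first by rewrite mulf_neq0.
  exact: cvgMl.
apply: (cvg_num_unique cl); apply: cvg_trans cr; apply: near_eq_cvg.
apply: filterS2 g1 g2 => k h1 h2 /=; apply/esym.
by apply: (jackson_nondegenerate complete p_lt1 q_neq0).
Qed.

End Perturbation.

(** * Initial segments of clusters *)

Section Cells.
Variables (n : nat) (N : 'I_n -> nat).
Local Notation I := {r : 'I_n & 'I_(N r)}.

Definition cells (k : 'I_n -> nat) : {set I} := [set u : I | (tagged u < k (tag u))%N].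

Lemma big_cells (T : Type) (idx : T) (op : Monoid.com_law idx) (k : 'I_n -> nat)
    (g : 'I_n -> nat -> T) : (forall r, k r <= N r)%N ->
  \big[op/idx]_(u in cells k) g (tag u) (tagged u) =
  \big[op/idx]_(r < n) \big[op/idx]_(0 <= i < k r) g r i.
Proof.
move=> le; rewrite (eq_bigr (fun r => \big[op/idx]_(i : 'I_(N r) | (i < k r)%N) g r i)).
  rewrite (sig_big_dep _ (fun r (i : 'I_(N r)) => (i < k r)%N) (fun r (i : 'I_(N r)) => g r i)).
  by apply: eq_bigl => u; rewrite inE.
by move=> r _; rewrite big_mkord (big_ord_widen (N r) (g r)).
Qed.

Lemma big_cellsC (T : Type) (idx : T) (op : Monoid.com_law idx) (k : 'I_n -> nat)
    (g : 'I_n -> nat -> T) : (forall r, k r <= N r)%N ->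
  \big[op/idx]_(u in [set: I] :\: cells k) g (tag u) (tagged u) =
  \big[op/idx]_(r < n) \big[op/idx]_(k r <= i < N r) g r i.
Proof.
move=> le; rewrite (eq_bigr (fun r => \big[op/idx]_(i : 'I_(N r) | (k r <= i)%N) g r i)).
  rewrite (sig_big_dep _ (fun r (i : 'I_(N r)) => (k r <= i)%N) (fun r (i : 'I_(N r)) => g r i)).
  by apply: eq_bigl => u; rewrite !inE andbT -leqNgt.
move=> r _; rewrite -(big_mkord (fun i => k r <= i)%N (g r)).
rewrite [RHS](big_cat_nat (n := k r)) //= [X in _ = op X _]big_nat_cond.
rewrite [X in _ = op X _]big1 ?Monoid.mul1m; last by move=> i h; exfalso; move: h; lia.
by rewrite [RHS]big_nat_cond [LHS]big_nat_cond; apply: eq_bigl => i; lia.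
Qed.

Lemma card_cells k : (forall r, k r <= N r)%N -> #|cells k| = (\sum_(r < n) k r)%N.
Proof.
move=> le; rewrite -sum1_card (big_cells _ (fun _ _ => 1%N)) //.
by apply: eq_bigr => r _; rewrite sum_nat_const_nat subn0 muln1.
Qed.

Lemma cellsT : cells N = [set: I].
Proof. by apply/setP => u; rewrite !inE ltn_ord. Qed.

Lemma cells_inj (j j' : {dffun forall r : 'I_n, 'I_(N r).+1}) :
  cells (fun r => j r) = cells (fun r => j' r) -> j = j'.
Proof.
move=> e; apply/ffunP => r; apply: val_inj; apply/eqP; rewrite eqn_leq.
suff h (l l' : {dffun forall r : 'I_n, 'I_(N r).+1}) :
    cells (fun r => l r) = cells (fun r => l' r) -> (l r <= l' r)%N by rewrite !h.
move=> {}e; rewrite leqNgt; apply/negP => lt.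
have ltN : (l' r < N r)%N by apply: leq_trans lt _; rewrite -ltnS.
have := congr1 (fun S : {set I} => Tagged (fun r => 'I_(N r)) (Ordinal ltN) \in S) e.
by rewrite !inE /= lt ltnn.
Qed.

Lemma initial_cells (S : {set I}) :
  (forall r (i i' : 'I_(N r)), i' = i.+1 :> nat ->
     Tagged (fun r => 'I_(N r)) i' \in S -> Tagged (fun r => 'I_(N r)) i \in S) ->
  exists j : {dffun forall r : 'I_n, 'I_(N r).+1}, S = cells (fun r => j r).
Proof.
move=> hS; pose tg r (i : 'I_(N r)) : I := Tagged (fun r => 'I_(N r)) i.
have down r (i i' : 'I_(N r)) : (i <= i')%N -> tg r i' \in S -> tg r i \in S.
  move: i'; suff h d (i' : 'I_(N r)) : i' = (i + d)%N :> nat -> tg r i' \in S -> tg r i \in S.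
    by move=> i' le; apply: (h (i' - i)%N); rewrite subnKC.
  elim: d i' => [|d IH] i' ei; first by rewrite (_ : i' = i) //; apply: val_inj; rewrite /= ei addn0.
  have lt : (i + d < N r)%N by apply: leq_ltn_trans (ltn_ord i'); rewrite ei addnS.
  by move=> hi'; apply: (IH (Ordinal lt)) => //; apply: hS hi'; rewrite ei addnS.
pose m r := \max_(i : 'I_(N r) | tg r i \in S) i.+1.
have lem r : (m r < (N r).+1)%N by rewrite ltnS; apply/bigmax_leqP.
exists [ffun r => Ordinal (lem r)]; apply/setP => -[r i]; rewrite !inE ffunE /=.
apply/idP/idP => [hi|]; first by apply: (leq_bigmax_cond (F := fun i : 'I_(N r) => i.+1)).
apply: contraTT => hi; rewrite -leqNgt; apply/bigmax_leqP => i' hi'.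
by rewrite ltnNge; apply: contra hi => le; apply: down hi'.
Qed.

End Cells.

(** * Specialization to geometric clusters *)

Section Clusters.
Variable C : numClosedFieldType.
Hypothesis complete : geo_complete C.
Variables (p q : C).
Hypothesis p_lt1 : `|p| < 1.
Hypothesis q_neq0 : q != 0.
Notation th := (theta p).
Notation sf := (tpoch p q).
Variables (n : nat) (N : 'I_n -> nat) (x : 'I_n -> C).
Hypothesis x_neq0 : forall r, x r != 0.
Hypothesis theta_ratio_neq0 : forall r s (e : int), r != s -> th (q ^ e * x r / x s) != 0.
Hypothesis theta_qpow_neq0 : forall k, th (q ^+ k.+1) != 0.
Local Notation I := {r : 'I_n & 'I_(N r)}.

Definition cluster (u : I) : C := x (tag u) * q ^+ tagged u.

Lemma cluster_neq0 u : cluster u != 0.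
Proof. by rewrite mulf_neq0 ?expf_neq0. Qed.

Lemma theta_qpowz_neq0 (e : int) : e != 0 -> th (q ^ e) != 0.
Proof.
case: e => [[|k]|k] // _; first exact: theta_qpow_neq0.
rewrite NegzE -exprnN (thetaV complete p_lt1) ?expf_neq0 //.
by rewrite mulf_neq0 ?oppr_eq0 ?invr_neq0 ?expf_neq0.
Qed.

Lemma theta_shifted_ratio_neq0 r s (e : int) : (r == s -> e != 0) ->
  th (q ^ e * x r / x s) != 0.
Proof.
have [->|rs] := eqVneq r s; last by move=> _; exact: theta_ratio_neq0.
by move=> /(_ isT) e0; rewrite mulfK //; exact: theta_qpowz_neq0.
Qed.

Lemma prod_theta_nat (y : C) m m' :
  \prod_(m <= l < m') th (y * q ^+ l) = sf (y * q ^+ m) (m' - m).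
Proof.
rewrite /tpoch -{1}[m]add0n big_addn; apply: eq_bigr => l _.
by rewrite addnC exprD mulrA.
Qed.

Lemma theta_telescope (y : C) k : th (q * y) != 0 ->
  (forall l, (l < k)%N -> th (y / q ^+ l) != 0) ->
  \prod_(0 <= l < k) (th (q * y / q ^+ l) / th (y / q ^+ l)) = th (q * y) / th (q * y / q ^+ k).
Proof.
move=> y1; elim: k => [|k IH] hy; first by rewrite big_geq // expr0 divr1 divff.
rewrite big_nat_recr //= IH => [|l lt]; last by apply: hy; apply: leq_trans lt _.
have -> : q * y / q ^+ k.+1 = y / q ^+ k.
  by rewrite exprS; field; rewrite ?q_neq0 ?expf_neq0.
have h1 := hy k (leqnn _).
have h2 : th (q * y / q ^+ k) != 0.
  case: k {IH h1} hy => [|k] hy; first by rewrite expr0 divr1.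
  rewrite (_ : q * y / _ = y / q ^+ k) ?hy //.
  by rewrite exprS; field; rewrite ?q_neq0 ?expf_neq0.
by field; rewrite ?h1 ?h2.
Qed.

(** The product over the elements of one initial segment telescopes, because
    q times one element of a cluster is the next one. *)
Lemma cross_cells (k : 'I_n -> nat) : (forall r, k r <= N r)%N ->
  cross p q cluster [set: I] (cells N k) =
  \prod_(r < n) \prod_(s < n)
    (sf (q * x r / x s * q ^+ k r) (N r - k r) /
     sf (q ^ (1 + (k r)%:Z - (k s)%:Z) * x r / x s) (N r - k r)).
Proof.
move=> le; rewrite /cross.
rewrite (big_cellsC _ (fun r i => \prod_(s in cells N k)
  (th (q * (x r * q ^+ i) / cluster s) / th (x r * q ^+ i / cluster s)))) //.
apply: eq_bigr => r _.
under eq_bigr => i _ do rewrite (big_cells _ (fun s l =>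
  th (q * (x r * q ^+ i) / (x s * q ^+ l)) / th (x r * q ^+ i / (x s * q ^+ l)))) //.
rewrite exchange_big /=; apply: eq_bigr => s _.
pose y i := x r * q ^+ i / x s.
have ypow (e : int) i : q ^ e * y i = q ^ (e + i%:Z) * x r / x s.
  by rewrite /y expfzDr // -exprnP; ring.
rewrite (eq_big_nat _ _ (F2 := fun i => th (q * x r / x s * q ^+ i) /
    th (q ^ (1 - (k s)%:Z) * x r / x s * q ^+ i))); last first.
  move=> i /andP[le1 lt1].
  have -> : q * x r / x s * q ^+ i = q * y i by rewrite /y; ring.
  have -> : q ^ (1 - (k s)%:Z) * x r / x s * q ^+ i = q * y i / q ^+ k s.
    by rewrite expfzDr // expr1z -exprnN /y; ring.
  rewrite -theta_telescope.
  - apply: eq_bigr => l _.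
    have e1 : x r * q ^+ i / (x s * q ^+ l) = y i / q ^+ l.
      by rewrite /y; field; rewrite ?x_neq0 ?expf_neq0.
    have e2 : q * (x r * q ^+ i) / (x s * q ^+ l) = q * y i / q ^+ l.
      by rewrite /y; field; rewrite ?x_neq0 ?expf_neq0.
    by rewrite e1 e2.
  - by rewrite -[q in q * _]expr1z ypow; apply: theta_shifted_ratio_neq0 => _; lia.
  - move=> l ltl; rewrite mulrC exprnN ypow; apply: theta_shifted_ratio_neq0 => /eqP ers.
    by move: le1 ltl; rewrite ers; lia.
rewrite big_split /= prodfV !prod_theta_nat; congr (_ / sf _ _).
have -> : 1 + (k r)%:Z - (k s)%:Z = 1 - (k s)%:Z + (k r)%:Z by ring.
rewrite [in RHS](expfzDr _ (k r)%:Z) // -exprnP; ring.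
Qed.

(** If S contains x_r q^(i+1) but not x_r q^i, the numerator theta(q z_u / z_v) of this
    pair is theta(1). *)
Lemma cross_not_initial (S : {set I}) :
  (forall k : {dffun forall r : 'I_n, 'I_(N r).+1}, S <> cells N (fun r => k r)) ->
  cross p q cluster [set: I] S = 0.
Proof.
move=> hS.
have [/existsP [u /existsP [v /and4P[/eqP euv /eqP ev vS uS]]]|hn] :=
    boolP [exists u : I, exists v : I,
      [&& tag u == tag v, nat_of_ord (tagged v) == (tagged u).+1, v \in S & u \notin S]].
  rewrite /cross (bigD1 u) ?inE ?uS //= (bigD1 v) //=.
  rewrite (_ : q * cluster u / cluster v = 1) ?theta1 ?mul0r //.
  have -> : cluster v = x (tag u) * q ^+ (tagged u).+1 by rewrite /cluster ev -euv.
  by rewrite /cluster exprS; field; rewrite ?x_neq0 ?q_neq0 ?expf_neq0.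
have [k e] : exists k : {dffun forall r : 'I_n, 'I_(N r).+1}, S = cells N (fun r => k r).
  apply: initial_cells => r i i' ei hi'; apply: contraNT hn => hi.
  apply/existsP; exists (Tagged (fun r => 'I_(N r)) i); apply/existsP.
  by exists (Tagged (fun r => 'I_(N r)) i'); rewrite /= eqxx ei eqxx hi' hi.
by case: (hS k).
Qed.

Lemma jackson_admissible_cluster (a d : C) :
  (forall r k, th (a * x r * q ^+ k.+1) != 0) -> (forall k, th (a * q / d * q ^+ k) != 0) ->
  jackson_admissible p q cluster a d [set: I].
Proof.
move=> ha hd; split=> //.
- exact: cluster_neq0.
- move=> [r j] [s l] _ _ ne.
  have -> : cluster (Tagged (fun r => 'I_(N r)) j) / cluster (Tagged (fun r => 'I_(N r)) l) =
      q ^ (j%:Z - l%:Z) * x r / x s.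
    rewrite /cluster /= expfzDr // -exprnN -exprnP.
    by field; rewrite ?x_neq0 ?expf_neq0.
  apply: theta_shifted_ratio_neq0 => /eqP ers; move: l ne; rewrite -ers => l.
  apply: contraNneq => e; apply/eqP; congr (Tagged _ _); apply: val_inj => /=; lia.
- move=> u k _; rewrite /cluster.
  by rewrite (_ : a * _ * _ = a * x (tag u) * q ^+ (tagged u + k).+1) // -addnS exprD; ring.
Qed.

Lemma jackson_cells (a c d lam : C) : a != 0 -> c != 0 -> d != 0 -> lam != 0 ->
  (forall r k, th (a * x r * q ^+ k.+1) != 0) -> (forall k, th (a * q / d * q ^+ k) != 0) ->
  \sum_(k : {dffun forall r : 'I_n, 'I_(N r).+1})
    jackson_term p q cluster a c d lam [set: I] (cells N (fun r => k r)) =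
  jackson_value p q cluster a c d lam [set: I].
Proof.
move=> a0 c0 d0 l0 ha hd.
rewrite -(jackson_subset complete p_lt1 q_neq0 a0 c0 d0 l0 (jackson_admissible_cluster ha hd)).
pose F := fun k : {dffun forall r : 'I_n, 'I_(N r).+1} => cells N (fun r => k r).
rewrite (bigID (fun S => S \in [set F k | k in setT])) /= [X in _ = _ + X]big1 ?addr0.
  rewrite -(big_imset (fun S => jackson_term p q cluster a c d lam [set: I] S)) /=; last first.
    by move=> k k' _ _; exact: cells_inj.
  apply: eq_bigl => S; rewrite subsetT.
  by apply/imsetP/imsetP => -[k _ ->]; exists k.
move=> S /andP[_ hS]; rewrite /jackson_term cross_not_initial ?mul0r // => k e.
by move/negP: hS; apply; rewrite e; apply: imset_f.
Qed.

End Clusters.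

(** * The WP Bailey pair *)

Section WPBaileyPair.
Variable C : numClosedFieldType.
Hypothesis complete : geo_complete C.
Variables (p q : C).
Hypothesis p_lt1 : `|p| < 1.
Hypothesis q_neq0 : q != 0.
Notation th := (theta p).
Notation sf := (tpoch p q).

Lemma tpoch_factor_neq0 (y : C) m k : tpoch p q y m != 0 -> (k < m)%N -> th (y * q ^+ k) != 0.
Proof.
rewrite /tpoch prodf_seq_neq0 => /allP h lt.
by have := h k; rewrite mem_index_iota lt => /(_ isT).
Qed.

Variables (n : nat) (x : 'I_n -> C) (c d a b : C).
Hypothesis x_neq0 : forall r, x r != 0.
Hypotheses (a_neq0 : a != 0) (b_neq0 : b != 0) (c_neq0 : c != 0) (d_neq0 : d != 0).
Hypothesis n_ge1 : (1 <= n)%N.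
Hypothesis generic : denominators_nonzero q p x c d a b.

Lemma generic_theta_ax r k : th (a * x r * q ^+ k.+1) != 0.
Proof.
have [_ h _ _ _] := generic; have [_ _ h3] := h r k.+1.
have := tpoch_factor_neq0 h3 (ltnSn k).
by rewrite (_ : a * x r * q * q ^+ k = a * x r * q ^+ k.+1) // exprS; ring.
Qed.

Lemma generic_theta_aqd k : th (a * q / d * q ^+ k) != 0.
Proof. by have [_ _ h _ _] := generic; exact: tpoch_factor_neq0 (h k.+1) (ltnSn k). Qed.

Lemma generic_theta_qpow k : th (q ^+ k.+1) != 0.
Proof.
have [_ _ _ h _] := generic; pose r := Ordinal n_ge1.
have := tpoch_factor_neq0 (h r r k.+1) (ltnSn k).
by rewrite mulfK // -exprS.
Qed.

Lemma generic_theta_ratio r s (e : int) : r != s -> th (q ^ e * x r / x s) != 0.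
Proof.
move=> rs; have [_ _ _ _ h] := generic.
(* the exponent 1 + j r - j s takes every integral value e *)
pose j : mindex n := fun i => if i == r then absz (Num.max (e - 1) 0) else absz (Num.max (1 - e) 0).
pose k : mindex n := fun i => if i == r then (j i).+1 else j i.
have le i : (j i <= k i)%N by rewrite /k; case: eqP.
have := h k j le r s.
have -> : (k r)%:Z - (j r)%:Z = Posz 1 by clear; rewrite /k eqxx; lia.
have -> : 1 + (j r)%:Z - (j s)%:Z = e.
  by clear - rs; rewrite /j eqxx eq_sym (negPf rs); lia.
by rewrite /qpfact big_nat1 expr0 mulr1.
Qed.

Variable N : mindex n.
Local Notation lam := (b / a).
Local Notation z := (cluster q (N := N) x).

Lemma jackson_term_cells (k : mindex n) : (forall r, k r <= N r)%N ->
  jackson_term p q z a c d lam [set: _] (cells N k) =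
  (\prod_(r < n) \prod_(s < n)
    (sf (q * x r / x s * q ^+ k r) (N r - k r) /
     sf (q ^ (1 + (k r)%:Z - (k s)%:Z) * x r / x s) (N r - k r)))
  * (sf lam (mabs N - mabs k)
     * (sf c (mabs k) * sf (a * q / (lam * c * d)) (mabs k) / sf (a * q / d) (mabs k))
     * lam ^+ mabs k)
  * \prod_(r < n) (sf (b * x r * q ^+ mabs N) (k r) * sf (d * x r) (k r)
                   / sf (a * x r * q ^+ mabs k) (k r))
  * \prod_(r < n) (sf (a * x r * q / c * q ^+ k r) (N r - k r)
                   * sf (b * c * d * x r / a * q ^+ k r) (N r - k r)
                   / sf (a * x r * q ^+ (mabs k).+1 * q ^+ k r) (N r - k r)).
Proof.
move=> le.
have cT : #|[set: {r : 'I_n & 'I_(N r)}]| = mabs N by rewrite -cellsT card_cells.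
rewrite /jackson_term cT card_cells // -/(mabs k).
rewrite (cross_cells complete p_lt1 q_neq0 x_neq0 generic_theta_ratio generic_theta_qpow) //.
congr (_ * _ * _).
- rewrite (big_cells _ (fun r i => th (lam * a * (x r * q ^+ i) * q ^+ mabs N) *
    th (d * (x r * q ^+ i)) / th (a * (x r * q ^+ i) * q ^+ mabs k))) //.
  apply: eq_bigr => r _; rewrite big_split /= prodfV big_split /=.
  congr (_ * _ / _); apply: eq_bigr => i _; congr th; last by ring.
    by field; rewrite ?a_neq0.
  by ring.
- rewrite (big_cellsC _ (fun r i => th (a * (x r * q ^+ i) * q / c) *
    th (lam * c * d * (x r * q ^+ i)) / th (a * (x r * q ^+ i) * q ^+ (mabs k).+1))) //.
  apply: eq_bigr => r _; rewrite big_split /= prodfV big_split /= -!prod_theta_nat.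
  congr (_ * _ / _); apply: eq_bigr => i _; congr th; ring.
Qed.

(** Once the shifted factorials are split at the index k r, the two sides agree factor
    by factor, except for those in a x_r. There the product over the cells ends at the index
    k_r + |k| - 1 and the one over the complement starts at k_r + |k| + 1; the
    very-well-poised factor theta(a x_r q^(k_r + |k|)) supplies the missing index. *)
Lemma B1_alpha_jackson (k : mindex n) : (forall r, k r <= N r)%N ->
  B1 q p x a b N k * wpb_alpha q p x c d a b k =
  (\prod_(r < n) sf (b * x r) (mabs N))
   / ((\prod_(r < n) \prod_(s < n) sf (q * x r / x s) (N r))
      * \prod_(r < n) (sf (a * x r * q / c) (N r) * sf (b * c * d * x r / a) (N r)))
  * jackson_term p q z a c d lam [set: _] (cells N k).
Proof.
move=> le; rewrite jackson_term_cells //.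
have [h1 h2 h3 h4 h5] := generic.
have leN : (mabs k <= mabs N)%N by apply: leq_sum => r _; exact: le.
pose t := mabs k; pose m := mabs N.
pose V1 := \prod_(r < n) \prod_(s < n)
  sf (q ^ (1 + (k r)%:Z - (k s)%:Z) * x r / x s) (N r - k r).
pose V2 := \prod_(r < n) \prod_(s < n) sf (q * x r / x s) (k r).
pose V3 := \prod_(r < n) \prod_(s < n) sf (q * x r / x s * q ^+ k r) (N r - k r).
have -> : \prod_(r < n) \prod_(s < n)
    (sf (q * x r / x s * q ^+ k r) (N r - k r) /
     sf (q ^ (1 + (k r)%:Z - (k s)%:Z) * x r / x s) (N r - k r)) = V3 / V1.
  rewrite /V1 /V3 -prodf_div; apply: eq_bigr => r _; exact: prodf_div.
have -> : \prod_(r < n) \prod_(s < n) sf (q * x r / x s) (N r) = V2 * V3.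
  rewrite /V2 /V3 -big_split; apply: eq_bigr => r _; rewrite -big_split.
  by apply: eq_bigr => s _; rewrite /= -tpochD subnKC.
have V30 : V3 != 0.
  apply/prodf_neq0 => r _; apply/prodf_neq0 => s _.
  have := h4 r s (N r); rewrite -[qpfact _ _ _ _]/(sf _ _) -{1}(subnKC (le r)) tpochD.
  by rewrite mulf_eq0 negb_or => /andP[].
have -> : B1 q p x a b N k = sf lam (m - t) / V1 *
    \prod_(r < n) (sf (b * x r) (k r + m) / sf (a * x r * q) (N r + t)).
  rewrite /B1 -/m -/t subzn //; congr (_ / _ * _).
  by apply: eq_bigr => r _; apply: eq_bigr => s _; rewrite subzn.
have -> : wpb_alpha q p x c d a b k = \prod_(r < n)
     (th (a * x r * q ^+ (k r + t)) / th (a * x r)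
      * (sf (a * x r) t * sf (d * x r) (k r)
         / (sf (a * x r * q / c) (k r) * sf (b * c * d * x r / a) (k r))))
    * (sf c t * sf (a * q / (lam * c * d)) t / (sf (a * q / d) t * V2)) * lam ^+ t.
  rewrite /wpb_alpha /qpfacts -/t !big_cons !big_nil !mulr1.
  congr (_ * (_ * _ / _) * _).
    by apply: eq_bigr => r _; rewrite !big_cons big_nil mulr1.
  by apply: (congr1 (fun y => sf y t)); field; rewrite ?a_neq0 ?b_neq0 ?c_neq0 ?d_neq0.
rewrite -/t -/m.
have key : (\prod_(r < n) (sf (b * x r) (k r + m) / sf (a * x r * q) (N r + t)))
    * \prod_(r < n) (th (a * x r * q ^+ (k r + t)) / th (a * x r)
      * (sf (a * x r) t * sf (d * x r) (k r)
         / (sf (a * x r * q / c) (k r) * sf (b * c * d * x r / a) (k r)))) =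
    (\prod_(r < n) sf (b * x r) m)
    / (\prod_(r < n) (sf (a * x r * q / c) (N r) * sf (b * c * d * x r / a) (N r)))
    * \prod_(r < n) (sf (b * x r * q ^+ m) (k r) * sf (d * x r) (k r)
                   / sf (a * x r * q ^+ t) (k r))
    * \prod_(r < n) (sf (a * x r * q / c * q ^+ k r) (N r - k r)
                   * sf (b * c * d * x r / a * q ^+ k r) (N r - k r)
                   / sf (a * x r * q ^+ t.+1 * q ^+ k r) (N r - k r)).
  rewrite -prodf_div -!big_split; apply: eq_bigr => r _ /=.
  have t1 : th (a * x r) != 0 by exact: h1.
  have [c1 c2 _] := h2 r (N r).
  have split_sf y : sf y (N r) = sf y (k r) * sf (y * q ^+ k r) (N r - k r).
    by rewrite -tpochD subnKC.
  have : sf (a * x r * q / c) (N r) != 0 by exact: c1.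
  rewrite split_sf mulf_eq0 negb_or => /andP[u1 u2].
  have : sf (b * c * d * x r / a) (N r) != 0 by exact: c2.
  rewrite split_sf mulf_eq0 negb_or => /andP[u3 u4].
  have az l : th (a * x r * q ^+ l) != 0.
    case: l => [|l]; first by rewrite expr0 mulr1.
    exact: generic_theta_ax.
  have sfz y l : (forall j, th (y * q ^+ j) != 0) -> sf y l != 0.
    by move=> hy; rewrite /tpoch prodf_seq_neq0; apply/allP => j _; rewrite hy implybT.
  have v1 l : sf (a * x r) l != 0 by apply: sfz.
  have v2 j l : sf (a * x r * q ^+ j) l != 0.
    by apply: sfz => i; rewrite -mulrA -exprD.
  have v3 l : sf (a * x r * q) l != 0 by rewrite -[q in a * x r * q]expr1.
  have v4 l j i : sf (a * x r * q ^+ l * q ^+ j) i != 0 by rewrite -mulrA -exprD.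
  have -> : sf (b * x r) (k r + m) = sf (b * x r) m * sf (b * x r * q ^+ m) (k r).
    by rewrite addnC tpochD.
  have ea : th (a * x r) * sf (a * x r * q) (N r + t) =
      sf (a * x r) t * sf (a * x r * q ^+ t) (k r) * th (a * x r * q ^+ (k r + t))
      * sf (a * x r * q ^+ t.+1 * q ^+ k r) (N r - k r).
    rewrite -tpochSl -tpochD [(t + k r)%N]addnC -tpochSr -mulrA -exprD.
    rewrite (_ : t.+1 + k r = (k r + t).+1)%N; last by rewrite addSn addnC.
    by rewrite -tpochD; congr (sf _ _); rewrite addSn addnAC subnKC.
  have -> : sf (a * x r * q) (N r + t) = (sf (a * x r) t * sf (a * x r * q ^+ t) (k r) *
      th (a * x r * q ^+ (k r + t)) * sf (a * x r * q ^+ t.+1 * q ^+ k r) (N r - k r)) / th (a * x r).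
    by rewrite -ea [RHS]mulrAC divff // mul1r.
  move: t1 u1 u2 u3 u4 (az (k r + t)%N) (v1 t) (v2 t (k r)) (v4 t.+1 (k r) (N r - k r)%N).
  clear.
  move: (th (a * x r)) (th (a * x r * q ^+ (k r + t))) (sf (a * x r) t)
    (sf (a * x r * q ^+ t) (k r)) (sf (a * x r * q ^+ t.+1 * q ^+ k r) (N r - k r))
    (sf (b * x r) m) (sf (b * x r * q ^+ m) (k r)) (sf (d * x r) (k r))
    (sf (a * x r * q / c) (k r)) (sf (a * x r * q / c * q ^+ k r) (N r - k r))
    (sf (b * c * d * x r / a) (k r)) (sf (b * c * d * x r / a * q ^+ k r) (N r - k r)).
  move=> y1 y2 y3 y4 y5 y6 y7 y8 y9 y10 y11 y12 e1 e2 e3 e4 e5 e6 e7 e8 e9.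
  by field; rewrite ?e1 ?e2 ?e3 ?e4 ?e5 ?e6 ?e7 ?e8 ?e9.
set P1 := \prod_(r < n) (sf (b * x r) (k r + m) / _) in key *.
set P2 := \prod_(r < n) (_ / _ * _) in key *.
set P3 := \prod_(r < n) sf (b * x r) m in key *.
set P4 := \prod_(r < n) (sf (a * x r * q / c) (N r) * _) in key *.
set P5 := \prod_(r < n) (_ * _ / sf (a * x r * q ^+ t) (k r)) in key *.
set P6 := \prod_(r < n) _ in key *.
set s1 := sf lam _; set s2 := sf c t; set s3 := sf _ t; set s4 := sf (a * q / d) t.
move: (lam ^+ t) => l; clearbody P1 P2 P3 P4 P5 P6 s1 s2 s3 s4 V1 V2 V3.
transitivity (P1 * P2 * (s1 / V1 * (s2 * s3 / (s4 * V2)) * l)); first by ring.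
rewrite key !invfM; transitivity (V3 / V3 * (P3 / P4 * P5 * P6 *
  (s1 / V1 * (s2 * s3 / s4 / V2) * l))); last by ring.
by rewrite divff // mul1r; ring.
Qed.

Lemma beta_jackson :
  wpb_beta q p x c d a b N =
  (\prod_(r < n) sf (b * x r) (mabs N))
   / ((\prod_(r < n) \prod_(s < n) sf (q * x r / x s) (N r))
      * \prod_(r < n) (sf (a * x r * q / c) (N r) * sf (b * c * d * x r / a) (N r)))
  * jackson_value p q z a c d lam [set: _].
Proof.
rewrite /wpb_beta /jackson_value.
have -> : #|[set: {r : 'I_n & 'I_(N r)}]| = mabs N by rewrite -cellsT card_cells.
rewrite -cellsT (big_cells _ (fun r i => th (lam * d * (x r * q ^+ i)))) //.
have -> : \prod_(r < n) \prod_(0 <= i < N r) th (lam * d * (x r * q ^+ i)) =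
    \prod_(r < n) sf (b * d * x r / a) (N r).
  apply: eq_bigr => r _; apply: eq_bigr => i _; congr th; ring.
rewrite /qpfacts !big_cons big_nil !mulr1.
have -> : \prod_(r < n) (qpfact q p (b * x r) (mabs N) * qpfact q p (b * d * x r / a) (N r) /
    \prod_(y <- [:: a * x r * q / c; b * c * d * x r / a]) qpfact q p y (N r)) =
  (\prod_(r < n) sf (b * x r) (mabs N)) * (\prod_(r < n) sf (b * d * x r / a) (N r)) /
  \prod_(r < n) (sf (a * x r * q / c) (N r) * sf (b * c * d * x r / a) (N r)).
  rewrite -big_split -prodf_div; apply: eq_bigr => r _.
  by rewrite !big_cons big_nil mulr1.
have -> : lam * c = b * c / a by ring.
rewrite -![qpfact _ _ _ (Posz _)]/(sf _ _).
set V := \prod_(r < n) \prod_(s < n) _; set W := \prod_(r < n) (_ * _).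
rewrite !invfM; ring.
Qed.

End WPBaileyPair.

Theorem theorem4p3 (R : realType) (n : nat) (q p : R[i]) (x : 'I_n -> R[i])
    (c d a b : R[i]) (n_ge1 : (1 <= n)%N)
    (q_neq0 : q != 0) (p_lt1 : `|p| < 1)
    (x_neq0 : forall r : 'I_n, x r != 0)
    (a_neq0 : a != 0) (b_neq0 : b != 0) (c_neq0 : c != 0) (d_neq0 : d != 0)
    (generic : denominators_nonzero q p x c d a b) :
  WP_Bailey_pair (B1 q p x) (wpb_alpha q p x c d) (wpb_beta q p x c d) a b.
Proof.
move=> N; have complete := @complex_geo_complete R.
rewrite beta_jackson.
rewrite -(jackson_cells complete p_lt1 q_neq0 N x_neq0
  (generic_theta_ratio generic) (generic_theta_qpow x_neq0 n_ge1 generic)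
  a_neq0 c_neq0 d_neq0 (mulf_neq0 b_neq0 (invr_neq0 a_neq0))
  (generic_theta_ax generic) (generic_theta_aqd generic)).
rewrite mulr_sumr; apply: eq_bigr => k _; apply/esym.
apply: (B1_alpha_jackson complete p_lt1 q_neq0 x_neq0 a_neq0 b_neq0 c_neq0 d_neq0 n_ge1 generic).
by move=> r; rewrite -ltnS.
Qed.
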